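(* Let $R\to S$ define a finite dominant morphism $f\colon\operatorname{Spec}S\to\operatorname{Spec}R$ between integral $F$-finite noetherian affine $\mathbb{F}_p$-schemes. Let $\mathfrak{a}\subsetneq R$ be a radical ideal with minimal primes $\mathfrak{p}_1,\dots,\mathfrak{p}_k$, and set $\mathfrak{b}=\sqrt{\mathfrak{a}S}$. Let $\sigma_R\colon S\to\omega_{S/R}=\operatorname{Hom}_R(S,R)$ be an $S$-linear generic isomorphism such that $T=\sigma_R(1)$ satisfies $$\sqrt{\mathfrak{p}_iS}=\{s\in S\mid T(sS)\subset\mathfrak{p}_i\}\quad\text{for all }i=1,\dots,k.\qquad( * )$$ Let $\mathcal{C}$ be a Cartier $R$-algebra acting on $R$ such that $R$ is $T$-transposable and $\mathfrak{a}\subset R$ is a Cartier submodule. Then the following hold. (a) The ideal $\mathfrak{b}\subset S$ is a Cartier $f^*\mathcal{C}$-submodule. (b) The pair $(R,\mathcal{C})$ is non-degenerate with respect to $\mathfrak{a}$ if and only if $(S,f^*\mathcal{C})$ is non-degenerate with respect to $\mathfrak{b}$. In that case, $T\big(f_*\tau_{\mathfrak{b}}(S,f^*\mathcal{C})\big)=\tau_{\mathfrak{a}}(R,\mathcal{C})$. (c) If $\mathfrak{a}=\mathfrak{p}$ is a prime ideal, then $(R,\mathcal{C})$ is non-degenerate with respect to $\mathfrak{a}$ if and only if $(S,f^*\mathcal{C})$ is non-degenerate with respect to all prime ideals $\mathfrak{q}\subset S$ lying over $\mathfrak{p}$. Further, for any such prime $\mathfrak{q}$ one has $T\big(f_*\tau_{\mathfrak{q}}(S,f^*\mathcal{C})\big)=\tau_{\mathfrak{p}}(R,\mathcal{C})$.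 (d) If $(R,\mathcal{C})$ is purely $F$-regular along $\mathfrak{a}$, then $T$ is surjective. The converse holds provided that $(S,f^*\mathcal{C})$ is purely $F$-regular along $\mathfrak{b}$.
   Context: $p$ is a prime, $q=p^e$, $f_*$ is restriction of scalars. ''Generic isomorphism'' means an isomorphism after tensoring with $\operatorname{Frac}(R)$. A Cartier $R$-algebra is an $\mathbb{N}$-graded ring $\mathcal{C}=\bigoplus_{e\ge0}\mathcal{C}_e$ with $\mathcal{C}_0=R$ and $r\cdot\kappa=\kappa\cdot r^{q}$ for $r\in R$, $\kappa\in\mathcal{C}_e$. It acts on $R$ via a homomorphism $\mathcal{C}\to\mathcal{C}_R=\bigoplus_e\operatorname{Hom}_R(F^e_*R,R)$ of Cartier algebras. A Cartier submodule (or $\mathcal{C}$-compatible ideal) is an ideal $I\subset R$ with $\kappa\cdot I\subset I$ for all $\kappa\in\mathcal{C}$. $f^*\mathcal{C}=\bigoplus_e\mathcal{C}_e\otimes_RS$ is the Cartier $S$-algebra with $s\cdot(\kappa_e\otimes s')=\kappa_e\otimes s^{q}s'$. $\varphi\in\operatorname{Hom}_R(F^e_*R,R)$ is $T$-transposable if there is a (necessarily unique) $\varphi^\top\in\operatorname{Hom}_S(F^e_*S,S)$ with $\varphi\circ F^e_*T=T\circ\varphi^\top$. $R$ is $T$-transposable if all homogeneous elements of $\mathcal{C}$ act on $R$ by $T$-transposable maps; then $f^*\mathcal{C}$ acts on $S$ by $\varphi\otimes s\mapsto\varphi^\top\cdot s$, $(\varphi^\top\cdot s)(F^e_*x)=\varphi^\top(F^e_*sx)$.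 Let $\mathfrak{a}\subset R$ be a radical $\mathcal{C}$-compatible ideal with minimal primes $\mathfrak{p}_1,\dots,\mathfrak{p}_k$ and $P=\bigcup_i\mathfrak{p}_i$. $(R,\mathcal{C})$ is non-degenerate with respect to $\mathfrak{a}$ if there is $e>0$ such that the ideal $\mathcal{C}_e(R)=\sum_{\kappa\in\mathcal{C}_e}\kappa\cdot R$ is not contained in $P$ (equivalently, $\mathcal{C}_e(R)\not\subset\mathfrak{p}_i$ for all $i$; equivalently, $(R,\mathcal{C})$ is non-degenerate with respect to each $\mathfrak{p}_i$). $\tau_{\mathfrak{a}}(R,\mathcal{C})$ is the smallest $\mathcal{C}$-compatible ideal of $R$ not contained in $P$; it exists if $(R,\mathcal{C})$ is non-degenerate with respect to $\mathfrak{a}$. $(R,\mathcal{C})$ is purely $F$-regular along $\mathfrak{a}$ if $\tau_{\mathfrak{a}}(R,\mathcal{C})$ exists and equals $R$. The same definitions apply to $(S,f^*\mathcal{C})$. In (c), the equality is for the case when these adjoint ideals exist (i.e. under non-degeneracy). *)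

(* Defs.v *)
From HB Require Import structures.
From mathcomp Require Import all_boot all_order all_algebra.
From mathcomp Require Import generic_quotient fraction.
From mathcomp Require Import boolp classical_sets functions.

Set Implicit Arguments.
Unset Strict Implicit.
Unset Printing Implicit Defensive.

Import GRing.Theory.
Local Open Scope ring_scope.
Local Open Scope classical_set_scope.
Local Open Scope quotient_scope.

(* The ideals of ring_quotient are decidable and proper; here ideals are
   arbitrary subsets and the unit ideal is allowed. *)
Section Ideals.
Variable R : comNzRingType.
Implicit Types I J P : set R.

Definition is_ideal I : Prop :=
  [/\ I 0, forall x y, I x -> I y -> I (x + y) & forall r x, I x -> I (r * x)].

Definition prime_ideal P : Prop :=
  [/\ is_ideal P, ~ P 1 & forall x y, P (x * y) -> P x \/ P y].

Definition radical I : set R := [set x | exists n : nat, I (x ^+ n)].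

Definition minimal_primes I : set (set R) :=
  [set P | [/\ prime_ideal P, I `<=` P &
    forall Q, prime_ideal Q -> I `<=` Q -> Q `<=` P -> Q = P]].

Definition ideal_gen (A : set R) : set R := smallest is_ideal A.

Definition noetherian : Prop :=
  forall I, is_ideal I -> exists gs : seq R, I = ideal_gen [set` gs].

End Ideals.

Arguments noetherian : clear implicits.

Section IdealMaps.
Variables (R S : comNzRingType) (f : {rmorphism R -> S}).

Definition extend (I : set R) : set S := ideal_gen (f @` I).

(* The image of Spec f is dense: a closed set V(I) of Spec R containing every
   f^-1(Q) is all of Spec R. *)
Definition dominant : Prop :=
  forall I : set R, is_ideal I ->
    (forall Q : set S, prime_ideal Q -> I `<=` f @^-1` Q) ->
    forall P : set R, prime_ideal P -> I `<=` P.

Definition lies_over (Q : set S) (P : set R) : Prop := f @^-1` Q = P.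

End IdealMaps.

Definition fg_module (R : pzRingType) (M : lmodType R) : Prop :=
  exists (n : nat) (g : 'I_n -> M), forall x : M,
    exists c : 'I_n -> R, x = \sum_(i < n) c i *: g i.

(* f_* M: the type M with scalars acting through f. *)
Definition restr (R S : pzRingType) (f : {rmorphism R -> S}) (M : lmodType S)
  : Type := M.

Section Restriction.
Variables (R S : pzRingType) (f : {rmorphism R -> S}) (M : lmodType S).

HB.instance Definition _ := GRing.Zmodule.copy (restr f M) M.

Let scale (r : R) (x : restr f M) : restr f M := f r *: (x : M).

Fact restr_scaleA r s x : scale r (scale s x) = scale (r * s) x.
Proof. by rewrite /scale scalerA rmorphM. Qed.
Fact restr_scale1 : left_id 1 scale.
Proof. by move=> x; rewrite /scale rmorph1 scale1r. Qed.
Fact restr_scaleDr : right_distributive scale +%R.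
Proof. by move=> r x y; rewrite /scale scalerDr. Qed.
Fact restr_scaleDl x : {morph scale^~ x : r s / r + s}.
Proof. by move=> r s; rewrite /scale rmorphD scalerDl. Qed.

HB.instance Definition _ := GRing.Zmodule_isLmodule.Build R (restr f M)
  restr_scaleA restr_scale1 restr_scaleDr restr_scaleDl.

Lemma restr_scaleE (r : R) (x : restr f M) : r *: x = f r *: (x : M) :> M.
Proof. by []. Qed.
End Restriction.

Definition finite_morphism (R S : pzRingType) (f : {rmorphism R -> S}) : Prop :=
  fg_module (restr f S^o).

Definition linhom (R : comPzRingType) (U V : lmodType R) : Type := {linear U -> V}.

Section LinHom.
Variables (R : comPzRingType) (U V : lmodType R).

Definition linhom_fun (phi : linhom U V) : U -> V := (phi : {linear U -> V}).
Coercion linhom_fun : linhom >-> Funclass.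
Definition linhom_of (phi : {linear U -> V}) : linhom U V := phi.

HB.instance Definition _ (phi : linhom U V) :=
  GRing.Linear.copy (linhom_fun phi) (phi : {linear U -> V}).

HB.instance Definition _ := gen_eqMixin (linhom U V).
HB.instance Definition _ := gen_choiceMixin (linhom U V).

Lemma linhomP (phi psi : linhom U V) : (forall x, phi x = psi x) -> phi = psi.
Proof.
case: phi psi => [p [[p0] [p1]]] [q [[q0] [q1]]] /funext epq.
have {}epq : p = q by [].
case: _ / epq q0 q1 => q0 q1.
by rewrite (Prop_irrelevance p0 q0) (Prop_irrelevance p1 q1).
Qed.

Let addh (phi psi : linhom U V) : linhom U V := linhom_of (phi \+ psi).
Let opph (phi : linhom U V) : linhom U V := linhom_of (\- phi).
Let zeroh : linhom U V := linhom_of \0.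
Fact linhom_addA : associative addh.
Proof. by move=> x y z; apply: linhomP => t; apply: addrA. Qed.
Fact linhom_addC : commutative addh.
Proof. by move=> x y; apply: linhomP => t; apply: addrC. Qed.
Fact linhom_add0 : left_id zeroh addh.
Proof. by move=> x; apply: linhomP => t; apply: add0r. Qed.
Fact linhom_addN : left_inverse zeroh opph addh.
Proof. by move=> x; apply: linhomP => t; apply: addNr. Qed.
HB.instance Definition _ := GRing.isZmodule.Build (linhom U V)
  linhom_addA linhom_addC linhom_add0 linhom_addN.

Lemma linhomDE (phi psi : linhom U V) x : linhom_fun (phi + psi) x = phi x + psi x.
Proof. by []. Qed.
Lemma linhom0E x : linhom_fun (0 : linhom U V) x = 0.
Proof. by []. Qed.
End LinHom.

(* Hom_R(f_* M, V) is an S-module through M. *)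
Section HomRestr.
Variables (R S : comPzRingType) (f : {rmorphism R -> S}).
Variables (M : lmodType S) (V : lmodType R).
Local Notation H := (linhom (restr f M) V).

Section Scale.
Variables (s : S) (phi : H).
Let h : restr f M -> V := fun x => phi ((s *: (x : M)) : restr f M).
Fact linhom_scale_is_linear : linear h.
Proof.
move=> r x y; rewrite /h restr_scaleE scalerDr scalerA [s * _]mulrC -scalerA.
by rewrite -[RHS](linearP phi).
Qed.
HB.instance Definition _ := GRing.isLinear.Build R (restr f M) V *:%R h
  linhom_scale_is_linear.
Definition linhom_scale : H := linhom_of h.
End Scale.

Fact linhom_scaleA s t phi : linhom_scale s (linhom_scale t phi) = linhom_scale (s * t) phi.
Proof.
by apply: linhomP => x; congr (phi _); rewrite /= scalerA mulrC.
Qed.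
Fact linhom_scale1 : left_id 1 linhom_scale.
Proof. by move=> phi; apply: linhomP => x; congr (phi _); rewrite /= scale1r. Qed.
Fact linhom_scaleDr : right_distributive linhom_scale +%R.
Proof. by move=> s phi psi; apply: linhomP. Qed.
Fact linhom_scaleDl phi : {morph linhom_scale^~ phi : s t / s + t}.
Proof.
move=> s t; apply: linhomP => x.
rewrite [LHS]/(phi _) scalerDl; exact: (raddfD (phi : {linear restr f M -> V})).
Qed.
HB.instance Definition _ := GRing.Zmodule_isLmodule.Build S H
  linhom_scaleA linhom_scale1 linhom_scaleDr linhom_scaleDl.

Lemma linhomZE (s : S) (phi : H) (x : M) : linhom_fun (s *: phi) x = phi (s *: x).
Proof. by []. Qed.
End HomRestr.

(* The relative dualizing module omega_{S/R} = Hom_R(S, R), an S-module. *)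
Notation omega f := (linhom (restr f _^o) _^o) (only parsing).

Section Tensor.
Variables (R : comPzRingType) (M N : lmodType R).

(* A formal sum of elementary tensors is a sequence of pairs. *)
Inductive tensor_rel : seq (M * N) -> seq (M * N) -> Prop :=
| tensor_refl s : tensor_rel s s
| tensor_sym s t : tensor_rel s t -> tensor_rel t s
| tensor_trans s t u : tensor_rel s t -> tensor_rel t u -> tensor_rel s u
| tensor_cat s s' t t' :
    tensor_rel s s' -> tensor_rel t t' -> tensor_rel (s ++ t) (s' ++ t')
| tensor_catC s t : tensor_rel (s ++ t) (t ++ s)
| tensor_0l n : tensor_rel [:: (0, n)] [::]
| tensor_Dl m m' n : tensor_rel [:: (m + m', n)] [:: (m, n); (m', n)]
| tensor_Dr m n n' : tensor_rel [:: (m, n + n')] [:: (m, n); (m, n')]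
| tensor_bal r m n : tensor_rel [:: (r *: m, n)] [:: (m, r *: n)].

Definition tensor_relb (s t : seq (M * N)) : bool := `[< tensor_rel s t >].

Fact tensor_relb_equiv : equiv_class_of tensor_relb.
Proof.
split=> [s|s t|t s u].
- by apply/asboolP; exact: tensor_refl.
- by apply/asboolP/asboolP; exact: tensor_sym.
- by move=> /asboolP st /asboolP tu; apply/asboolP; exact: tensor_trans tu.
Qed.
Canonical tensor_equiv := EquivRelPack tensor_relb_equiv.

Definition tensor : Type := {eq_quot tensor_relb}.
HB.instance Definition _ : EqQuotient _ tensor_relb tensor :=
  EqQuotient.on tensor.
HB.instance Definition _ := Choice.on tensor.

Definition tensor_class (s : seq (M * N)) : tensor := \pi_tensor s.
Definition pure (m : M) (n : N) : tensor := tensor_class [:: (m, n)].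

Lemma tensor_classP s t : tensor_class s = tensor_class t <-> tensor_rel s t.
Proof.
rewrite /tensor_class; split=> [/eqP|st].
  by rewrite piE => /asboolP.
by apply/eqP; rewrite piE; apply/asboolP.
Qed.

Lemma tensor_classK (x : tensor) : tensor_class (repr x) = x.
Proof. exact: reprK. Qed.

Definition negs (s : seq (M * N)) : seq (M * N) := [seq (- x.1, x.2) | x <- s].

Lemma tensor_rel_negs s : tensor_rel (negs s ++ s) [::].
Proof.
elim: s => [|[m n] s IH]; first exact: tensor_refl.
apply: (@tensor_trans _ ([:: (- m, n)] ++ (s ++ negs s) ++ [:: (m, n)])).
  apply: (@tensor_cat [:: (- m, n)]); first exact: tensor_refl.
  apply: (@tensor_trans _ (((m, n) :: s) ++ negs s)); first exact: tensor_catC.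
  exact: (@tensor_catC [:: (m, n)] (s ++ negs s)).
apply: (@tensor_trans _ ([:: (- m, n)] ++ [::] ++ [:: (m, n)])).
  apply: tensor_cat; first exact: tensor_refl.
  apply: tensor_cat; last exact: tensor_refl.
  exact: tensor_trans (tensor_catC _ _) IH.
apply: (@tensor_trans _ [:: (- m + m, n)]); first exact/tensor_sym/tensor_Dl.
by rewrite addNr; exact: tensor_0l.
Qed.

Let addt (x y : tensor) := tensor_class (repr x ++ repr y).
Let oppt (x : tensor) := tensor_class (negs (repr x)).
Let zerot := tensor_class [::].

Lemma tensor_class_rel s : tensor_rel (repr (tensor_class s)) s.
Proof. by apply/tensor_classP; rewrite tensor_classK. Qed.

Let addtE s t : addt (tensor_class s) (tensor_class t) = tensor_class (s ++ t).
Proof. by apply/tensor_classP/tensor_cat; exact: tensor_class_rel. Qed.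

Fact tensor_addA : associative addt.
Proof.
move=> x y z; rewrite -(tensor_classK x) -(tensor_classK y) -(tensor_classK z).
by rewrite !addtE catA.
Qed.
Fact tensor_addC : commutative addt.
Proof. by move=> x y; apply/tensor_classP/tensor_catC. Qed.
Fact tensor_add0 : left_id zerot addt.
Proof. by move=> x; rewrite -(tensor_classK x) addtE. Qed.
Fact tensor_addN : left_inverse zerot oppt addt.
Proof.
move=> x; rewrite -{2}(tensor_classK x) addtE.
exact/tensor_classP/tensor_rel_negs.
Qed.
HB.instance Definition _ := GRing.isZmodule.Build tensor
  tensor_addA tensor_addC tensor_add0 tensor_addN.

Lemma tensor_class_cat s t :
  tensor_class (s ++ t) = tensor_class s + tensor_class t.
Proof. by rewrite -addtE. Qed.

Lemma pureDl m m' n : pure (m + m') n = pure m n + pure m' n.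
Proof. by rewrite -tensor_class_cat; exact/tensor_classP/tensor_Dl. Qed.
Lemma pureDr m n n' : pure m (n + n') = pure m n + pure m n'.
Proof. by rewrite -tensor_class_cat; exact/tensor_classP/tensor_Dr. Qed.
Lemma pure_bal r m n : pure (r *: m) n = pure m (r *: n).
Proof. exact/tensor_classP/tensor_bal. Qed.

Lemma pure0l n : pure 0 n = 0.
Proof. by apply: (addIr (pure 0 n)); rewrite -pureDl !add0r. Qed.

Lemma tensor_ind (P : tensor -> Prop) :
  P 0 -> (forall m n x, P x -> P (pure m n + x)) -> forall x, P x.
Proof.
move=> P0 PD x; rewrite -(tensor_classK x); elim: (repr x) => [|[m n] s IH] //.
by rewrite -cat1s tensor_class_cat; exact: PD.
Qed.

Section Lift.
Variables (G : zmodType) (b : M -> N -> G).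

Definition balanced : Prop :=
  [/\ forall m m' n, b (m + m') n = b m n + b m' n,
      forall m n n', b m (n + n') = b m n + b m n' &
      forall r m n, b (r *: m) n = b m (r *: n)].

Hypothesis hb : balanced.

(* The proof of balancedness is an argument so that tlift carries a
   zmodMorphism structure. *)
Definition tlift of balanced : tensor -> G :=
  fun x => \sum_(i <- repr x) b i.1 i.2.

Lemma tlift_class s :
  tlift hb (tensor_class s) = \sum_(i <- s) b i.1 i.2.
Proof.
rewrite /tlift; have [bDl bDr bZ] := hb.
have := tensor_class_rel s; move: (repr _) => s' ss'.
elim: ss' => {s s'} //=.
- by move=> s t u _ -> _ ->.
- by move=> s s' t t' _ e1 _ e2; rewrite !big_cat /= e1 e2.
- by move=> s t; rewrite !big_cat /= addrC.
- move=> n; rewrite big_seq1 big_nil /=; apply: (addIr (b 0 n)).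
  by rewrite -bDl !add0r.
- by move=> m m' n; rewrite big_seq1 big_cons big_seq1 /=.
- by move=> m n n'; rewrite big_seq1 big_cons big_seq1 /=.
- by move=> r m n; rewrite !big_seq1 /=.
Qed.

Lemma tlift_pure m n : tlift hb (pure m n) = b m n.
Proof. by rewrite tlift_class big_seq1. Qed.

Fact tlift_is_zmod_morphism : zmod_morphism (tlift hb).
Proof.
have D x y : tlift hb (x + y) = tlift hb x + tlift hb y.
  rewrite -(tensor_classK x) -(tensor_classK y) -tensor_class_cat.
  by rewrite !tlift_class big_cat.
by move=> x y; apply: (addIr (tlift hb y)); rewrite -D !subrK.
Qed.
HB.instance Definition _ := GRing.isZmodMorphism.Build tensor G (tlift hb)
  tlift_is_zmod_morphism.
End Lift.

Lemma tensor_hom_ext (G : zmodType) (g h : {additive tensor -> G}) :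
  (forall m n, g (pure m n) = h (pure m n)) -> g =1 h.
Proof.
move=> gh; elim/tensor_ind => [|m n x IH]; first by rewrite !raddf0.
by rewrite !raddfD IH gh.
Qed.
End Tensor.

Section TensorMap.
Variables (R : comPzRingType) (M M' N : lmodType R) (u : {linear M -> M'}).

Fact tensor_map_balanced :
  balanced (fun (m : M) (n : N) => pure (u m) n).
Proof.
split=> [m m' n|m n n'|r m n].
- by rewrite raddfD pureDl.
- exact: pureDr.
- by rewrite linearZ /= pure_bal.
Qed.

Definition tensor_map : tensor M N -> tensor M' N := tlift tensor_map_balanced.
End TensorMap.

Section RestrMap.
Variables (R S : comPzRingType) (f : {rmorphism R -> S}) (M M' : lmodType S).

Definition restr_map (u : {linear M -> M'}) : restr f M -> restr f M' := u.

Variable u : {linear M -> M'}.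
Fact restr_map_is_linear : linear (restr_map u).
Proof. by move=> r x y; rewrite /restr_map !restr_scaleE linearP. Qed.
HB.instance Definition _ := GRing.isLinear.Build R (restr f M) (restr f M')
  *:%R (restr_map u) restr_map_is_linear.
End RestrMap.
Arguments restr_map {R S} f {M M'} u.

Definition Frac_module (R : idomainType) : lmodType R :=
  restr (@FracField.tofrac R) {fraction R}^o.

(* u becomes an isomorphism after applying - (x)_R Frac R. *)
Definition generic_iso (R : idomainType) (S : comPzRingType)
    (f : {rmorphism R -> S}) (M M' : lmodType S) (u : {linear M -> M'}) : Prop :=
  bijective (@tensor_map R (restr f M) (restr f M') (Frac_module R)
    (restr_map f u : {linear restr f M -> restr f M'})).

(* An N-graded ring is given by its homogeneous components, and the product of
   degrees d and e lands in any degree n with a proof of d + e = n, so that no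
   transport along equalities of degrees is needed. *)
Record cartier_algebra (p : nat) (R : comPzRingType) := CartierAlgebra {
  cdeg :> nat -> zmodType;
  cmul : forall d e n : nat, (d + e)%N = n -> cdeg d -> cdeg e -> cdeg n;
  cscal : R -> cdeg 0;
  cmulDl : forall d e n (h : (d + e)%N = n) x y z,
    cmul h (x + y) z = cmul h x z + cmul h y z;
  cmulDr : forall d e n (h : (d + e)%N = n) x y z,
    cmul h x (y + z) = cmul h x y + cmul h x z;
  cmulA : forall d e k de ek n (h1 : (d + e)%N = de) (h2 : (de + k)%N = n)
      (h3 : (e + k)%N = ek) (h4 : (d + ek)%N = n) x y z,
    cmul h4 x (cmul h3 y z) = cmul h2 (cmul h1 x y) z;
  cmul1l : forall e (h : (0 + e)%N = e) x, cmul h (cscal 1) x = x;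
  cmul1r : forall e (h : (e + 0)%N = e) x, cmul h x (cscal 1) = x;
  cscalD : forall r s, cscal (r + s) = cscal r + cscal s;
  cscalM : forall (h : (0 + 0)%N = 0%N) r s,
    cmul h (cscal r) (cscal s) = cscal (r * s);
  cscal_bij : bijective cscal;
  cmul_scal : forall e (h1 : (0 + e)%N = e) (h2 : (e + 0)%N = e) r x,
    cmul h1 (cscal r) x = cmul h2 x (cscal (r ^+ (p ^ e)))
}.

Record cartier_hom (p : nat) (R : comPzRingType) (C D : cartier_algebra p R) :=
  CartierHom {
    chom :> forall e, C e -> D e;
    chomD : forall e (x y : C e), chom (x + y) = chom x + chom y;
    chomM : forall d e n (h : (d + e)%N = n) (x : C d) (y : C e),
      chom (cmul h x y) = cmul h (chom x) (chom y);
    chom_scal : forall r, chom (cscal C r) = cscal D r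
  }.

Definition frob (R : comNzRingType) (p : nat) of p \in [pchar R] :=
  fun (e : nat) (x : R) => x ^+ (p ^ e).

Section Frobenius.
Variables (R : comNzRingType) (p : nat) (chR : p \in [pchar R]) (e : nat).

Fact frob_is_zmod_morphism : zmod_morphism (frob chR e).
Proof.
rewrite /frob; elim: e => [|k IH] x y; first by rewrite expn0 !expr1.
rewrite expnSr !exprM IH -!(pFrobenius_autE chR); exact: raddfB.
Qed.
Fact frob_is_monoid_morphism : monoid_morphism (frob chR e).
Proof. by split=> [|x y]; rewrite /frob ?expr1n ?exprMn. Qed.
HB.instance Definition _ := GRing.isZmodMorphism.Build R R (frob chR e)
  frob_is_zmod_morphism.
HB.instance Definition _ := GRing.isMonoidMorphism.Build R R (frob chR e)
  frob_is_monoid_morphism.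
End Frobenius.

Definition F_finite (R : comNzRingType) (p : nat) (chR : p \in [pchar R]) : Prop :=
  finite_morphism (frob chR 1).

Section FullCartier.
Variables (p : nat) (R : comNzRingType) (chR : p \in [pchar R]).

(* The p^-e-linear maps on R, i.e. Hom_R(F^e_* R, R). *)
Definition pinv_linear (e : nat) : Type := linhom (restr (frob chR e) R^o) R^o.
HB.instance Definition _ e := GRing.Zmodule.copy (pinv_linear e)
  (linhom (restr (frob chR e) R^o) R^o).

Definition pinv_fun e (phi : pinv_linear e) : R -> R := linhom_fun phi.
Coercion pinv_fun : pinv_linear >-> Funclass.

Lemma pinv_linearP e (phi psi : pinv_linear e) : phi =1 psi -> phi = psi.
Proof. exact: (@linhomP R (restr (frob chR e) R^o) R^o). Qed.
Lemma pinv_linearD e (phi : pinv_linear e) (x y : R) :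
  phi (x + y) = phi x + phi y.
Proof. exact: (raddfD (phi : {linear restr (frob chR e) R^o -> R^o})). Qed.
Lemma pinv_linearZ e (phi : pinv_linear e) (r x : R) :
  phi (r ^+ (p ^ e) * x) = r * phi x.
Proof.
exact: (linearZ_LR (phi : {linear restr (frob chR e) R^o -> R^o}) r
  (x : restr (frob chR e) R^o)).
Qed.
Lemma pinv_addE e (phi psi : pinv_linear e) (x : R) :
  pinv_fun (phi + psi) x = phi x + psi x.
Proof. by []. Qed.

Section Build.
Variables (e : nat) (g : R -> R).
Hypothesis gD : forall x y, g (x + y) = g x + g y.
Hypothesis gZ : forall r x, g (r ^+ (p ^ e) * x) = r * g x.
Let h : restr (frob chR e) R^o -> R^o := g.
Fact pinv_build_is_linear : linear h.
Proof. by move=> r x y; rewrite /h gD; congr (_ + _); exact: gZ. Qed.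
HB.instance Definition _ := GRing.isLinear.Build R _ _ *:%R h
  pinv_build_is_linear.
Definition pinv_build : pinv_linear e := linhom_of h.
End Build.

Lemma pinv_buildE e g gD gZ x : @pinv_build e g gD gZ x = g x.
Proof. by []. Qed.

Section Ops.
Variables (d e n : nat) (h : (d + e)%N = n).
Variables (phi : pinv_linear d) (psi : pinv_linear e).
Fact pinv_comp_D x y : phi (psi (x + y)) = phi (psi x) + phi (psi y).
Proof. by rewrite !pinv_linearD. Qed.
Fact pinv_comp_Z r x : phi (psi (r ^+ (p ^ n) * x)) = r * phi (psi x).
Proof. by rewrite -h expnD exprM !pinv_linearZ. Qed.
(* phi \o F^d_* psi *)
Definition pinv_comp : pinv_linear n := pinv_build pinv_comp_D pinv_comp_Z.
End Ops.

Definition pinv_scal (r : R) : pinv_linear 0 :=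
  @pinv_build 0 (fun x => r * x) (mulrDr r) (fun s x => mulrCA r s x).

Fact pinv_scal_bij : bijective pinv_scal.
Proof.
exists (fun phi : pinv_linear 0 => phi 1) => [r|phi].
  by rewrite pinv_buildE mulr1.
apply: pinv_linearP => x; rewrite pinv_buildE mulrC -pinv_linearZ mulr1.
by rewrite expn0 expr1.
Qed.

Definition full_cartier : cartier_algebra p R.
Proof.
refine (@CartierAlgebra p R (fun e => pinv_linear e) pinv_comp pinv_scal
  _ _ _ _ _ _ _ pinv_scal_bij _).
- by move=> *; exact: pinv_linearP.
- move=> d e n h phi psi psi'; apply: pinv_linearP => x.
  exact: (pinv_linearD phi (psi x) (psi' x)).
- by move=> *; exact: pinv_linearP.
- by move=> e h phi; apply: pinv_linearP => x; exact: mul1r.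
- move=> e h phi; apply: pinv_linearP => x.
  exact: (congr1 (pinv_fun phi) (mul1r x)).
- by move=> r s; apply: pinv_linearP => x; exact: (mulrDl r s x).
- by move=> h r s; apply: pinv_linearP => x; exact: (mulrA r s x).
- move=> e h1 h2 r phi; apply: pinv_linearP => x.
  exact: (esym (pinv_linearZ phi r x)).
Defined.

End FullCartier.

Section RightModule.
Variables (p : nat) (R : comPzRingType) (C : cartier_algebra p R) (e : nat).

(* C_e as a right R-module (R is commutative, so this is a module), as opposed
   to the left action, which differs from it by F^e. *)
Definition right_module : Type := C e.
HB.instance Definition _ := GRing.Zmodule.copy right_module (C e).

Let scale (r : R) (x : right_module) : right_module :=
  cmul (addn0 e) x (cscal C r).
Fact right_scaleA r s x : scale r (scale s x) = scale (r * s) x.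
Proof.
rewrite /scale -(cmulA (addn0 e) _ (addn0 0) (addn0 e)) cscalM.
by rewrite mulrC.
Qed.
Fact right_scale1 : left_id 1 scale.
Proof. by move=> x; rewrite /scale cmul1r. Qed.
Fact right_scaleDr : right_distributive scale +%R.
Proof. by move=> r x y; rewrite /scale cmulDl. Qed.
Fact right_scaleDl x : {morph scale^~ x : r s / r + s}.
Proof. by move=> r s; rewrite /scale cscalD cmulDr. Qed.
HB.instance Definition _ := GRing.Zmodule_isLmodule.Build R right_module
  right_scaleA right_scale1 right_scaleDr right_scaleDl.

Lemma right_scaleE (r : R) (x : right_module) :
  r *: x = cmul (addn0 e) (x : C e) (cscal C r).
Proof. by []. Qed.
End RightModule.

Section Pullback.
Variables (p : nat) (R S : comNzRingType) (chS : p \in [pchar S]).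
Variables (f : {rmorphism R -> S}) (C : cartier_algebra p R).

Definition pullback_deg (e : nat) : zmodType :=
  tensor (right_module C e) (restr f S^o).

Definition ptensor e (x : C e) (s : S) : pullback_deg e :=
  @pure R (right_module C e) (restr f S^o) x s.

Lemma ptensorDl e (x y : C e) s : ptensor (x + y) s = ptensor x s + ptensor y s.
Proof. exact: pureDl. Qed.
Lemma ptensorDr e (x : C e) s t : ptensor x (s + t) = ptensor x s + ptensor x t.
Proof. exact: pureDr. Qed.
Lemma ptensor_bal e (h : (e + 0)%N = e) (x : C e) r s :
  ptensor (cmul h x (cscal C r)) s = ptensor x (f r * s).
Proof. by rewrite (eq_irrelevance h (addn0 e)); exact: pure_bal. Qed.

Lemma pullback_ind e (P : pullback_deg e -> Prop) :
  P 0 -> (forall x s v, P v -> P (ptensor x s + v)) -> forall v, P v.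
Proof. exact: (@tensor_ind R (right_module C e) (restr f S^o) P). Qed.

Section Mul.
Variables (d e n : nat) (h : (d + e)%N = n).

Definition pmul_pure (x : C d) (s : S) (y : C e) (t : S) : pullback_deg n :=
  ptensor (cmul h x y) (s ^+ (p ^ e) * t).

Fact pmul_balr x s : balanced (M := right_module C e) (N := restr f S^o)
  (pmul_pure x s).
Proof.
split=> [y y' t|y t t'|r y t]; rewrite /pmul_pure.
- by rewrite cmulDr ptensorDl.
- by rewrite mulrDr ptensorDr.
- rewrite right_scaleE (cmulA h (addn0 n)) ptensor_bal mulrCA.
  by [].
Qed.

Let pmul_r x s : pullback_deg e -> pullback_deg n := tlift (pmul_balr x s).
Let pmul_r0 x s : pmul_r x s 0 = 0.
Proof. exact: raddf0. Qed.
Let pmul_rE x s y t v :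
  pmul_r x s (ptensor y t + v) = pmul_pure x s y t + pmul_r x s v.
Proof. by rewrite /pmul_r raddfD /= tlift_pure. Qed.

Fact pmul_ball :
  balanced (M := right_module C d) (N := restr f S^o) pmul_r.
Proof.
have frD (s t : S) : (s + t) ^+ (p ^ e) = s ^+ (p ^ e) + t ^+ (p ^ e).
  exact: (raddfD (frob chS e)).
split=> [x x' s|x s s'|r x s]; apply: funext => v; rewrite ?addrfctE;
  elim/pullback_ind: v => [|y t v IH]; rewrite ?pmul_r0 ?addr0 //;
  rewrite !pmul_rE IH /pmul_pure.
- by rewrite cmulDl ptensorDl addrACA.
- by rewrite frD mulrDl ptensorDr addrACA.
- congr (_ + _); rewrite right_scaleE -(cmulA _ _ (add0n e) h).
  rewrite (cmul_scal _ (addn0 e)) (cmulA h (addn0 n)) ptensor_bal.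
  by rewrite restr_scaleE exprMn rmorphXn mulrA.
Qed.

(* (x (x) s) * (y (x) t) = xy (x) s^(p^e) t, for y of degree e *)
Definition pmul (u : pullback_deg d) (v : pullback_deg e) : pullback_deg n :=
  tlift pmul_ball u v.

Lemma pmulE x s y t :
  pmul (ptensor x s) (ptensor y t) = ptensor (cmul h x y) (s ^+ (p ^ e) * t).
Proof. by rewrite /pmul tlift_pure -[ptensor y t]addr0 pmul_rE pmul_r0 addr0. Qed.
Lemma pmulDl u u' v : pmul (u + u') v = pmul u v + pmul u' v.
Proof. by rewrite /pmul raddfD. Qed.
Lemma pmulDr u v v' : pmul u (v + v') = pmul u v + pmul u v'.
Proof.
elim/pullback_ind: u => [|x s u IH]; first by rewrite /pmul raddf0 addr0.
by rewrite !pmulDl IH /pmul !tlift_pure /pmul_r raddfD addrACA.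
Qed.
Lemma pmul0l v : pmul 0 v = 0.
Proof. by apply: (addIr (pmul 0 v)); rewrite -pmulDl !add0r. Qed.
Lemma pmul0r u : pmul u 0 = 0.
Proof. by apply: (addIr (pmul u 0)); rewrite -pmulDr !add0r. Qed.
End Mul.

Definition pscal (s : S) : pullback_deg 0 := ptensor (cscal C 1) s.

Fact pscal_bij : bijective pscal.
Proof.
have [g gK Kg] := cscal_bij C.
have gD x y : g (x + y) = g x + g y.
  by apply: (can_inj gK); rewrite cscalD !Kg.
have gM h x r : g (cmul h x (cscal C r)) = g x * r.
  by apply: (can_inj gK); rewrite -(cscalM _ h) !Kg.
have hb : balanced (M := right_module C 0) (N := restr f S^o)
    (fun (x : C 0) (s : S) => f (g x) * s).
  split=> [x y s|x s t|r x s].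
  - by rewrite gD rmorphD mulrDl.
  - by rewrite mulrDr.
  - by rewrite right_scaleE gM rmorphM restr_scaleE -mulrA.
exists (tlift hb) => [s|]; first by rewrite /pscal /ptensor tlift_pure gK rmorph1 mul1r.
elim/pullback_ind => [|x s v IH].
  by rewrite raddf0 /pscal; apply: (addIr (ptensor (cscal C 1) 0));
     rewrite -ptensorDr !add0r.
rewrite raddfD {1}/pscal ptensorDr; congr (_ + _); last exact: IH.
by rewrite /= {2}/ptensor tlift_pure -(ptensor_bal (addn0 0)) cscalM mul1r Kg.
Qed.

Definition pullback : cartier_algebra p S.
Proof.
refine (@CartierAlgebra p S pullback_deg pmul pscal
  _ _ _ _ _ _ _ pscal_bij _).
- exact: pmulDl.
- exact: pmulDr.
- move=> d e k de ek n h1 h2 h3 h4 u v w.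
  elim/pullback_ind: u => [|x s u IHu]; first by rewrite !pmul0l.
  rewrite !pmulDl IHu; congr (_ + _) => {u IHu}.
  elim/pullback_ind: v => [|y t v IHv]; first by rewrite !(pmul0l, pmul0r).
  rewrite !(pmulDl, pmulDr) IHv; congr (_ + _) => {v IHv}.
  elim/pullback_ind: w => [|z r w IHw]; first by rewrite !pmul0r.
  rewrite !pmulDr IHw; congr (_ + _).
  by rewrite !pmulE (cmulA h1 h2) -h3 exprMn -exprM -expnD mulrA.
- move=> e h; elim/pullback_ind => [|x s v IH]; first by rewrite pmul0r.
  by rewrite pmulDr IH pmulE cmul1l expr1n mul1r.
- move=> e h; elim/pullback_ind => [|x s v IH]; first by rewrite pmul0l.
  by rewrite pmulDl IH pmulE cmul1r expn0 expr1 mulr1.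
- by move=> s t; rewrite /pscal ptensorDr.
- by move=> h s t; rewrite pmulE cscalM mulr1 expn0 expr1.
- move=> e h1 h2 r; elim/pullback_ind => [|x s v IH].
    by rewrite pmul0l pmul0r.
  rewrite pmulDl pmulDr IH; congr (_ + _).
  by rewrite !pmulE cmul1l cmul1r expn0 expr1 mulrC.
Defined.

Lemma pullback_scalE e (h : (0 + e)%N = e) (s : S) (k : C e) (t : S) :
  cmul (c := pullback) h (cscal pullback s) (ptensor k t) =
  ptensor k (s ^+ (p ^ e) * t).
Proof. by rewrite [LHS]pmulE cmul1l. Qed.
End Pullback.

Definition cartier_action (p : nat) (R : comNzRingType) (chR : p \in [pchar R])
  (C : cartier_algebra p R) : Type := cartier_hom C (full_cartier chR).

Section CartierAction.
Variables (p : nat) (R : comNzRingType) (chR : p \in [pchar R]).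
Variables (C : cartier_algebra p R) (alpha : cartier_action chR C).

Definition act_map (e : nat) (k : C e) : pinv_linear chR e :=
  (alpha : cartier_hom _ _) e k.

(* C_e(R) *)
Definition trace_ideal (e : nat) : set R :=
  [set y | exists (n : nat) (k : 'I_n -> C e) (x : 'I_n -> R),
    y = \sum_(i < n) act_map (k i) (x i)].

(* Stability under the homogeneous elements amounts to stability under all of
   C, since I is closed under sums. *)
Definition cartier_submodule (I : set R) : Prop :=
  is_ideal I /\ forall (e : nat) (k : C e) (x : R), I x -> I (act_map k x).

Definition prime_union (I : set R) : set R :=
  \bigcup_(P in minimal_primes I) P.

Definition nondegenerate_wrt (I : set R) : Prop :=
  exists2 e : nat, (0 < e)%N & ~ trace_ideal e `<=` prime_union I.

(* t = tau_I(R, C) *)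
Definition is_adjoint_ideal (I t : set R) : Prop :=
  [/\ cartier_submodule t, ~ t `<=` prime_union I &
    forall J, cartier_submodule J -> ~ J `<=` prime_union I -> t `<=` J].

(* The adjoint ideal exists and is the unit ideal. *)
Definition purely_F_regular (I : set R) : Prop := is_adjoint_ideal I setT.

End CartierAction.

Section Transpose.
Variables (p : nat) (R S : comNzRingType).
Variables (chR : p \in [pchar R]) (chS : p \in [pchar S]).
Variables (f : {rmorphism R -> S}) (T : linhom (restr f S^o) R^o).

Definition is_transpose e (phi : pinv_linear chR e) (psi : pinv_linear chS e) :
  Prop := forall x : S, phi (T x) = T (psi x).

Definition transposable e (phi : pinv_linear chR e) : Prop :=
  exists psi : pinv_linear chS e, is_transpose phi psi.

(* Meaningful when phi is transposable; unique by T_separates. *)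
Definition transpose e (phi : pinv_linear chR e) : pinv_linear chS e :=
  xget 0 [set psi | is_transpose phi psi].

Definition action_transposable (C : cartier_algebra p R)
    (alpha : cartier_action chR C) : Prop :=
  forall e (k : C e), transposable (act_map alpha k).

(* (psi . s)(F^e_* x) = psi(F^e_* (s x)) *)
Definition pinv_premul e (psi : pinv_linear chS e) (s : S) : pinv_linear chS e :=
  @pinv_build p S chS e (fun x => psi (s * x))
    (fun x y => etrans (congr1 psi (mulrDr s x y)) (pinv_linearD psi _ _))
    (fun r x => etrans (congr1 psi (mulrCA s _ x)) (pinv_linearZ psi r _)).

(* s |-> T(s -) is injective *)
Definition nondegenerate_form : Prop :=
  forall s : S, (forall x, T (s * x) = 0) -> s = 0.

Lemma T_additive x y : T (x + y) = T x + T y.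
Proof. exact: (raddfD (T : {linear restr f S^o -> R^o})). Qed.

Lemma T_scale r x : T (f r * x) = r * T x.
Proof.
exact: (linearZ_LR (T : {linear restr f S^o -> R^o}) r (x : restr f S^o)).
Qed.

Hypothesis nT : nondegenerate_form.

Lemma T_separates e (psi psi' : pinv_linear chS e) :
  (forall x, T (psi x) = T (psi' x)) -> psi = psi'.
Proof.
move=> eT; apply: pinv_linearP => x; apply/eqP; rewrite -subr_eq0; apply/eqP.
apply: nT => s; rewrite mulrC mulrBr -!pinv_linearZ.
by apply: (addIr (T (psi' (s ^+ (p ^ e) * x)))); rewrite -T_additive subrK eT add0r.
Qed.

Lemma transposeE e (phi : pinv_linear chR e) (psi : pinv_linear chS e) :
  is_transpose phi psi -> transpose phi = psi.
Proof.
move=> tp; apply: xget_unique => // psi' tp'.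
by apply: T_separates => x; rewrite -tp -tp'.
Qed.

Lemma transposeP e (phi : pinv_linear chR e) :
  transposable phi -> is_transpose phi (transpose phi).
Proof. exact: xgetPex. Qed.

Section PullbackAction.
Variables (C : cartier_algebra p R) (alpha : cartier_action chR C).
Hypothesis tr : action_transposable alpha.

Let tp e (k : C e) : pinv_linear chS e := transpose (act_map alpha k).
Let tpP e (k : C e) : is_transpose (act_map alpha k) (tp k).
Proof. exact/transposeP/tr. Qed.

Let actD e (k l : C e) x :
  act_map alpha (k + l) x = act_map alpha k x + act_map alpha l x.
Proof. by rewrite /act_map chomD. Qed.
Let actM d e n (h : (d + e)%N = n) (k : C d) (l : C e) x :
  act_map alpha (cmul h k l) x = act_map alpha k (act_map alpha l x).
Proof. by rewrite /act_map chomM. Qed.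
Let act_scal r x : act_map alpha (cscal C r) x = r * x.
Proof. by rewrite /act_map chom_scal. Qed.

Let tpD e (k l : C e) x : tp (k + l) x = tp k x + tp l x.
Proof.
rewrite /tp (@transposeE _ _ ((tp k : pinv_linear chS e) + tp l)) // => y.
by rewrite actD pinv_addE T_additive -!tpP.
Qed.
Let tpM d e n (h : (d + e)%N = n) (k : C d) (l : C e) x :
  tp (cmul h k l) x = tp k (tp l x).
Proof.
rewrite /tp (@transposeE _ _ (pinv_comp h (tp k) (tp l))) // => y.
by rewrite actM pinv_buildE -!tpP.
Qed.
Let tp_scal r x : tp (cscal C r) x = f r * x.
Proof.
rewrite /tp (@transposeE _ _ (pinv_scal chS (f r))) // => y.
by rewrite act_scal pinv_buildE T_scale.
Qed.

Fact pullback_act_balanced e :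
  balanced (M := right_module C e) (N := restr f S^o)
    (fun (k : C e) (s : S) => pinv_premul (tp k) s).
Proof.
split=> [k l s|k s t|r k s]; apply: pinv_linearP => x.
- exact: (tpD k l (s * x)).
- by rewrite pinv_buildE mulrDl; exact: (pinv_linearD (tp k)).
- by rewrite !pinv_buildE right_scaleE tpM tp_scal restr_scaleE -mulrA.
Qed.

(* f^*C acts on S by k (x) s |-> k^T . s *)
Definition pullback_act e : pullback chS f C e -> pinv_linear chS e :=
  tlift (pullback_act_balanced e).

Lemma pullback_actE e (k : C e) s x :
  pullback_act (ptensor f k s : pullback chS f C e) x =
  transpose (act_map alpha k) (s * x).
Proof. by rewrite /pullback_act tlift_pure. Qed.

Let actPD e (u v : pullback chS f C e) x :
  pullback_act (u + v) x = pullback_act u x + pullback_act v x.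
Proof.
by rewrite [pullback_act (u + v)](raddfD (tlift (pullback_act_balanced e))).
Qed.
Let actP0 e x : pullback_act (0 : pullback chS f C e) x = 0.
Proof.
by apply: (addIr (pullback_act (0 : pullback chS f C e) x));
   rewrite -actPD !add0r.
Qed.

Definition pullback_action : cartier_action chS (pullback chS f C).
Proof.
refine (@CartierHom p S (pullback chS f C) (full_cartier chS)
  pullback_act _ _ _).
- by move=> e u v; apply: pinv_linearP => x; exact: actPD.
- move=> d e n h u v; apply: pinv_linearP => x.
  change (pullback_act (pmul chS h u v) x = pullback_act u (pullback_act v x)).
  elim/pullback_ind: u => [|k s u IHu]; first by rewrite pmul0l !actP0.
  rewrite pmulDl !actPD IHu; congr (_ + _) => {u IHu}.
  elim/pullback_ind: v => [|l t v IHv].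
    rewrite pmul0r !actP0.
    by rewrite pullback_actE mulr0; apply: (addIr (tp k 0)); rewrite -pinv_linearD !add0r.
  rewrite pmulDr !actPD IHv !pullback_actE mulrDr pinv_linearD; congr (_ + _).
  by rewrite pmulE pullback_actE [LHS]tpM -mulrA pinv_linearZ.
- move=> s; apply: pinv_linearP => x.
  by rewrite [LHS]pullback_actE [LHS]tp_scal rmorph1 mul1r.
Defined.

End PullbackAction.
End Transpose.

Section GenericIso.
Variables (R S : idomainType) (f : {rmorphism R -> S}).

Lemma dominant_inj : dominant f -> injective f.
Proof.
move=> fdom; have id0 : prime_ideal [set 0 : R].
  split=> [|/eqP|x y /= /eqP]; last 2 first.
  - by rewrite oner_eq0.
  - by rewrite mulf_eq0 => /orP[] /eqP; [left|right].
  by split=> //= [x y -> ->|r x ->]; rewrite ?addr0 ?mulr0.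
have idk : is_ideal [set x : R | f x = 0].
  split=> /= [|x y fx fy|r x fx]; first exact: rmorph0.
  - by rewrite rmorphD fx fy addr0.
  - by rewrite rmorphM fx mulr0.
have k0 : [set x : R | f x = 0] `<=` [set 0].
  by apply: fdom => // Q [[Q0 _ _] _ _] x /= ->.
move=> x y fxy; apply/eqP; rewrite -subr_eq0; apply/eqP/k0 => /=.
by rewrite rmorphB fxy subrr.
Qed.

Section FracMap.
Hypothesis finj : injective f.
Local Notation "x %:F" := (FracField.tofrac x).

Let phiF (k : {fraction R}) : {fraction S} :=
  (f \n_(repr k))%:F / (f \d_(repr k))%:F.

Let fracE (k : {fraction R}) : k = (\n_(repr k))%:F / (\d_(repr k))%:F.
Proof.
rewrite -{1}[k]reprK; move: (repr k) => x.
have d0 : \d_x != 0 by exact: denom_ratioP.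
rewrite -[x in LHS]Ratio_numden; apply: (@mulIf _ (\d_x)%:F).
  by rewrite tofrac_eq0.
rewrite mulfVK ?tofrac_eq0 // -[_ * _]/(FracField.mul _ _).
apply/eqP; rewrite !piE /FracField.mulf /= !numden_Ratio ?oner_neq0 ?mulr1 //.
by rewrite /equivf !numden_Ratio ?oner_neq0 ?mulf_neq0 // ?mulr1 mulrC.
Qed.

Let f_neq0 x : x != 0 -> (f x)%:F != 0 :> {fraction S}.
Proof. by rewrite tofrac_eq0 -(inj_eq finj) rmorph0. Qed.

Let phiFE n d : d != 0 -> phiF (n%:F / d%:F) = (f n)%:F / (f d)%:F.
Proof.
move=> d0; rewrite /phiF; set k : {fraction R} := n%:F / d%:F.
have k0 : \d_(repr k) != 0 by exact: denom_ratioP.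
have /eqP := fracE k; rewrite {1}/k eqr_div ?tofrac_eq0 //.
rewrite -!tofracM tofrac_eq => /eqP e.
by apply/eqP; rewrite eqr_div ?f_neq0 // -!tofracM -!rmorphM /= e.
Qed.

Let phiFD x y : phiF (x + y) = phiF x + phiF y.
Proof.
rewrite (fracE x) (fracE y) addf_div ?tofrac_eq0 ?denom_ratioP //.
rewrite -!tofracM -tofracD !phiFE ?mulf_neq0 ?denom_ratioP //.
by rewrite addf_div ?f_neq0 ?denom_ratioP // rmorphD !rmorphM /= tofracD !tofracM.
Qed.

Let phiFZ r x : phiF (r%:F * x) = (f r)%:F * phiF x.
Proof.
rewrite (fracE x) mulrA -tofracM !phiFE ?denom_ratioP //.
by rewrite rmorphM tofracM mulrA.
Qed.

Lemma pure1_eq0 (s : S) :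
  @pure R (restr f S^o) (Frac_module R) s (1 : {fraction R}) = 0 -> s = 0.
Proof.
pose b (s : S) (k : {fraction R}) : {fraction S} := s%:F * phiF k.
have bZ r (x : S) (k : {fraction R}) : b (f r * x) k = b x (r%:F * k).
  by rewrite /b phiFZ tofracM mulrA [(f r)%:F * x%:F]mulrC.
have hb : @balanced R (restr f S^o) (Frac_module R) _ b.
  split=> [x y k|x k l|r x k]; rewrite /b.
  - by rewrite tofracD mulrDl.
  - by rewrite phiFD mulrDr.
  - exact: bZ.
move=> /(congr1 (tlift hb)); rewrite tlift_pure raddf0 /b.
rewrite -[1]divr1 -tofrac1 phiFE ?oner_neq0 // rmorph1 tofrac1 divr1 mulr1.
by move/eqP; rewrite tofrac_eq0 => /eqP.
Qed.
End FracMap.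

Lemma generic_iso_nondegenerate (sigma : {linear S^o -> omega f}) :
  dominant f -> generic_iso f sigma -> nondegenerate_form (sigma 1).
Proof.
move=> /dominant_inj finj /bij_inj sinj s Ts0; apply: (pure1_eq0 finj).
apply: sinj; rewrite /tensor_map raddf0 tlift_pure.
have s0 : sigma s = 0.
  apply: linhomP => x; rewrite -[s]mulr1 (linearZ_LR sigma s 1).
  exact: Ts0.
by rewrite [X in pure X _]s0; exact: pure0l.
Qed.

End GenericIso.

(* Main.v *)
Require Import Defs.
From HB Require Import structures.
From mathcomp Require Import all_boot all_order all_algebra.
From mathcomp Require Import zify.
From mathcomp Require Import boolp classical_sets functions.

Set Implicit Arguments.
Unset Strict Implicit.

Import GRing.Theory.
Local Open Scope ring_scope.
Local Open Scope classical_set_scope.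

(* Write phi' for the transpose of phi. By (star), every minimal prime q of b is
   a colon ideal {z | T(xzS) is contained in p} with x not in q, for a minimal
   prime p of a, and every minimal p occurs; the same holds for every prime q
   over a when a = p is prime, by incomparability. Since T(phi'(s) t) =
   phi(T(t^q s)), such pairs (q, p) satisfy C_e(R) <= p iff (f^*C)_e(S) <= q, and
   the operations J |-> T(J) and J |-> {s | T(sS) is contained in J} carry
   compatible ideals to compatible ideals and respect non-containment in the
   primes; applied to the adjoint ideals they give the equality.

   Adjoint ideals exist because the compatible ideals not contained in P have a
   common element outside P. Fix phi in C_e with g = phi(1) outside P. For a
   compatible prime Q0 not containing g, F^e_*(R/Q0) becomes free after inverting
   some d, with dual basis among the premultiples of phi, so a compatible ideal
   J containing Q0 satisfies d^m J <= J^2 + Q0, and d lies in the radical of J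
   if J <> Q0. Noetherian induction yields c outside P in all
   compatible primes that neither contain g nor lie in P; as the colon ideal
   (J : g^oo) is radical, some power of gc lies in J, and then
   phi((gc)^(qm) c^q) = (gc)^(m+1) brings the exponent down to 3. *)

(** * Ideals, radicals and minimal primes of a noetherian ring *)

Section IdealBasics.
Variable R : comNzRingType.
Implicit Types I J P Q : set R.

Section Closure.
Variables (I : set R) (idI : is_ideal I).

Lemma ideal0 : I 0. Proof. by case: idI. Qed.

Lemma idealD x y : I x -> I y -> I (x + y).
Proof. by case: idI => _ + _; apply. Qed.

Lemma idealMl r x : I x -> I (r * x).
Proof. by case: idI => _ _; apply. Qed.

Lemma idealMr r x : I x -> I (x * r).
Proof. by rewrite mulrC; exact: idealMl. Qed.

Lemma idealN x : I x -> I (- x).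
Proof. by rewrite -mulN1r; exact: idealMl. Qed.

Lemma idealB x y : I x -> I y -> I (x - y).
Proof. by move=> Ix /idealN; exact: idealD. Qed.

Lemma ideal_sum (K : Type) (s : seq K) (F : K -> R) :
  (forall k, I (F k)) -> I (\sum_(k <- s) F k).
Proof. by move=> IF; elim/big_ind: _ => //; [exact: ideal0|exact: idealD]. Qed.

Lemma idealX n x : (0 < n)%N -> I x -> I (x ^+ n).
Proof. by case: n => // n _ Ix; rewrite exprS; exact: idealMr. Qed.

End Closure.

Lemma prime_is_ideal P : prime_ideal P -> is_ideal P.
Proof. by case. Qed.

Lemma prime_notM P x y : prime_ideal P -> ~ P x -> ~ P y -> ~ P (x * y).
Proof. by case=> _ _ PM Px Py /PM[]. Qed.

Lemma prime_exp P n x : prime_ideal P -> P (x ^+ n) -> P x.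
Proof.
move=> [_ P1 PM]; elim: n => [/P1 //|n IH]; rewrite exprS => /PM[] //.
Qed.

Lemma ideal_setT : is_ideal (@setT R).
Proof. by split. Qed.

Lemma sub_radical I : I `<=` radical I.
Proof. by move=> x Ix; exists 1%N. Qed.

Lemma radical_sub_prime I P : prime_ideal P -> I `<=` P -> radical I `<=` P.
Proof. by move=> Pp IP x [n /IP]; exact: prime_exp. Qed.

Lemma radical_is_ideal I : is_ideal I -> is_ideal (radical I).
Proof.
move=> idI; split=> [|x y [n In] [m Im]|r x [n In]].
- by exists 1%N; exact: ideal0.
- exists (n + m)%N; rewrite exprDn; apply: ideal_sum => // i.
  rewrite -mulr_natl; apply: idealMl => //.
  have [nk|kn] := leqP m i.
    by rewrite -(subnK nk) exprD mulrA; exact: idealMl.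
  apply: idealMr => //; rewrite -(subnK (_ : n <= n + m - i)%N).
    by rewrite exprD; exact: idealMl.
  by rewrite -addnBA ?leq_addr // ltnW.
- by exists n; rewrite exprMn; exact: idealMl.
Qed.

Lemma radicalK I : radical (radical I) = radical I.
Proof.
rewrite eqEsubset; split; last exact: sub_radical.
by move=> x [n [m]]; rewrite -exprM => ?; exists (n * m)%N.
Qed.

Lemma extend_is_ideal (A : comNzRingType) (f : {rmorphism A -> R}) (I : set A) :
  is_ideal (extend f I).
Proof.
split=> [J [idJ _]|x y Ix Iy J [idJ sJ]|r x Ix J [idJ sJ]].
- exact: ideal0.
- by apply: idealD => //; [exact: Ix|exact: Iy].
- by apply: idealMl => //; exact: Ix.
Qed.

Lemma sub_extend (A : comNzRingType) (f : {rmorphism A -> R}) (I : set A) x :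
  I x -> extend f I (f x).
Proof. by move=> Ix J [_]; apply; exists x. Qed.

Lemma extend_sub (A : comNzRingType) (f : {rmorphism A -> R}) (I : set A) J :
  is_ideal J -> I `<=` f @^-1` J -> extend f I `<=` J.
Proof. by move=> idJ IJ x; apply; split=> // _ [y /IJ ? <-]. Qed.

Lemma preimage_prime (A : comNzRingType) (f : {rmorphism A -> R}) P :
  prime_ideal P -> prime_ideal (f @^-1` P).
Proof.
move=> [idP P1 PM]; split=> [||x y] /=; last by rewrite rmorphM => /PM.
- split=> [|x y|r x] /=; rewrite ?rmorph0 ?rmorphD ?rmorphM.
  + exact: ideal0.
  + exact: idealD.
  + exact: idealMl.
- by rewrite rmorph1.
Qed.

(** This is [I + Rx], written as a congruence modulo [I]. *)
Definition adjoin I (x : R) : set R := [set z | exists r, I (z - r * x)].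

Section Adjoin.
Variables (I : set R) (idI : is_ideal I) (x : R).

Lemma adjoin_is_ideal : is_ideal (adjoin I x).
Proof.
split=> [|y z [r Iy] [s Iz]|t y [r Iy]].
- by exists 0; rewrite mul0r subr0; exact: ideal0.
- by exists (r + s); rewrite mulrDl opprD addrACA; exact: idealD.
- by exists (t * r); rewrite -mulrA -mulrBr; exact: idealMl.
Qed.

Lemma sub_adjoin : I `<=` adjoin I x.
Proof. by move=> z Iz; exists 0; rewrite mul0r subr0. Qed.

Lemma mem_adjoin : adjoin I x x.
Proof. by exists 1; rewrite mul1r subrr; exact: ideal0. Qed.

Lemma adjoin_min J : is_ideal J -> I `<=` J -> J x -> adjoin I x `<=` J.
Proof.
by move=> idJ IJ Jx z [r /IJ Jz]; rewrite -(subrK (r * x) z);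
   apply: idealD => //; exact: idealMl.
Qed.
End Adjoin.

Lemma adjoinM I x y u v : is_ideal I -> I (x * y) ->
  adjoin I x u -> adjoin I y v -> I (u * v).
Proof.
move=> idI Ixy [r Iu] [s Iv].
rewrite -[u](subrK (r * x)) -[v](subrK (s * y)) mulrDl.
apply: idealD => //; first exact: idealMr.
rewrite mulrDr; apply: idealD => //; first exact: idealMl.
by rewrite mulrACA; exact: idealMl.
Qed.

(** Otherwise every counterexample lies strictly inside another one. Choice then gives a strictly
    ascending chain, and the finitely many generators of its union already lie in one member. *)
Lemma noetherian_ind (H : noetherian R) (Pr : set R -> Prop) :
  (forall I, is_ideal I ->
     (forall J, is_ideal J -> I `<=` J -> ~ J `<=` I -> Pr J) -> Pr I) ->
  forall I, is_ideal I -> Pr I.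
Proof.
move=> IH I0 idI0; apply: contrapT => nPr.
pose bad := {I : set R | is_ideal I /\ ~ Pr I}.
have next (B : bad) : exists B' : bad,
    sval B `<=` sval B' /\ ~ sval B' `<=` sval B.
  case: B => I [idI nI] /=; apply: contrapT => no; apply: nI; apply: IH => //.
  move=> J idJ IJ nJI; apply: contrapT => nJ; apply: no.
  by exists (exist _ J (conj idJ nJ)).
have [nx nxP] := choice next.
pose I n := sval (iter n nx (exist _ I0 (conj idI0 nPr))).
have idI n : is_ideal (I n) by rewrite /I; case: (iter _ _ _) => ? [].
have IS n m : (n <= m)%N -> I n `<=` I m.
  elim: m => [|m IHm]; first by rewrite leqn0 => /eqP ->.
  rewrite leq_eqVlt => /predU1P[-> //|/IHm]; move/subset_trans; apply.
  by case: (nxP (iter m nx (exist _ I0 (conj idI0 nPr)))).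
have idU : is_ideal (\bigcup_n I n).
  split=> [|x y [n _ In] [m _ Im]|r x [n _ In]].
  - by exists 0%N => //; exact: ideal0.
  - exists (maxn n m) => //; apply: idealD => //.
      by apply: IS In; exact: leq_maxl.
    by apply: IS Im; exact: leq_maxr.
  - by exists n => //; exact: idealMl.
have [gs gsE] := H _ idU.
have gsU : [set` gs] `<=` \bigcup_n I n.
  by rewrite gsE => x xg J [_]; apply.
have [N gN] : exists N, [set` gs] `<=` I N.
  elim: gs gsU {gsE} => [|g gs IHgs] gU; first by exists 0%N.
  have [|N gN] := IHgs; first by move=> x /= xg; apply: gU; rewrite /= inE xg orbT.
  have [|n _ gn] := gU g; first by rewrite /= mem_head.
  exists (maxn n N) => x /=; rewrite inE => /predU1P[->|xg].
    by apply: IS gn; exact: leq_maxl.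
  by apply: (IS N); [exact: leq_maxr|exact: gN].
have UN : \bigcup_n I n `<=` I N by rewrite gsE => x; apply; split.
case: (nxP (iter N nx (exist _ I0 (conj idI0 nPr)))) => _; apply => x xN.
by apply: UN; exists N.+1.
Qed.

(* x is a product of elements of the ideals P, each chosen outside Q. *)
Lemma prime_avoid_inter Q (Ps : seq (set R)) : prime_ideal Q ->
  (forall P, P \in Ps -> is_ideal P /\ ~ P `<=` Q) ->
  exists2 x, ~ Q x & forall P, P \in Ps -> P x.
Proof.
move=> Qp; elim: Ps => [|P Ps IH] PsP.
  by exists 1; [case: Qp|].
have [x Qx xPs] : exists2 x, ~ Q x & forall P, P \in Ps -> P x.
  by apply: IH => P' P'P; apply: PsP; rewrite inE P'P orbT.
have [idP nPQ] := PsP P (mem_head _ _).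
have [y Py Qy] : exists2 y, P y & ~ Q y.
  apply: contrapT => no; apply: nPQ => y Py; apply: contrapT => Qy.
  by apply: no; exists y.
exists (x * y); first exact: prime_notM.
move=> P'; rewrite inE => /predU1P[->|P'P]; first exact: idealMl.
by apply: idealMr (xPs _ P'P); case: (PsP P') => //; rewrite inE P'P orbT.
Qed.

(** Keeps the inclusion-minimal members: a new set is dropped if it contains a kept one, and
    otherwise evicts the kept sets that contain it. *)
Lemma incomparable_subseq (Ps : seq (set R)) : exists Qs : seq (set R),
  [/\ {subset Qs <= Ps}, forall P, P \in Ps -> exists2 Q, Q \in Qs & Q `<=` P &
      forall P Q, P \in Qs -> Q \in Qs -> Q `<=` P -> Q = P].
Proof.
elim: Ps => [|P Ps [Qs [QsP PsQ inc]]]; first by exists [::].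
have [[Q QQ QP]|no] := pselect (exists2 Q, Q \in Qs & Q `<=` P).
  exists Qs; split=> // [Q' /QsP|P']; first by rewrite inE orbC => ->.
  by rewrite inE => /predU1P[->|/PsQ //]; exists Q.
exists (P :: [seq Q <- Qs | ~~ `[< P `<=` Q >]]); split.
- move=> Q; rewrite !inE mem_filter => /predU1P[->|/andP[_ /QsP ->]].
    by rewrite eqxx.
  by rewrite orbT.
- move=> P'; rewrite inE => /predU1P[->|/PsQ[Q QQ QP']].
    by exists P => //; rewrite mem_head.
  have [PQ|nPQ] := pselect (P `<=` Q).
    by exists P; [rewrite mem_head|exact: subset_trans QP'].
  exists Q => //; rewrite inE mem_filter QQ andbT; apply/orP; right.
  by apply/asboolPn.
- move=> P' Q; rewrite !inE !mem_filter.
  case/predU1P=> [->|/andP[/asboolPn nPP' P'Q]];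
    case/predU1P=> [->|/andP[/asboolPn nPQ QQ]] //.
  + by move=> QP; case: no; exists Q.
  + exact: inc.
Qed.

(** Noetherian induction: if [x * y] lies in [I] but neither factor does, the lists for [I + Rx] and
    [I + Ry] are joined, as the product of these two ideals lies in [I]. The inclusion-minimal
    members of the list are then the minimal primes. *)
Lemma minimal_primes_finite I : noetherian R -> is_ideal I ->
  exists Ps : seq (set R), (forall P, P \in Ps <-> minimal_primes I P) /\
    (forall x, (forall P, P \in Ps -> P x) -> radical I x).
Proof.
move=> noeth idI.
have [Ps PsP PsI] : exists2 Ps : seq (set R),
    (forall P, P \in Ps -> prime_ideal P /\ I `<=` P) &
    forall x, (forall P, P \in Ps -> P x) -> radical I x.
  elim/(noetherian_ind noeth): I / idI => I idI IH.
  have [I1|nI1] := pselect (I 1).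
    (* For the unit ideal the list is empty, and every [x] is in the radical because
       [x ^+ 0 = 1]. *)
    by exists [::] => // x _; exists 0%N.
  have [Ip|nIp] := pselect (prime_ideal I).
    exists [:: I] => [P|x]; first by rewrite inE => /eqP ->; split.
    by move=> /(_ I (mem_head _ _)) Ix; exact: sub_radical.
  have [x [y [Ixy Ix Iy]]] : exists x y, [/\ I (x * y), ~ I x & ~ I y].
    apply: contrapT => no; apply: nIp; split=> // x y Ixy.
    apply: contrapT => /not_orP[nx ny]; apply: no; exists x, y; split=> //.
  have adj z : ~ I z -> exists2 Ps : seq (set R),
      (forall P, P \in Ps -> prime_ideal P /\ adjoin I z `<=` P) &
      forall x, (forall P, P \in Ps -> P x) -> radical (adjoin I z) x.
    move=> nz; apply: IH; [exact: adjoin_is_ideal|exact: sub_adjoin|].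
    by move=> /(_ z (mem_adjoin idI z)).
  have [Ps PsP PsI] := adj _ Ix; have [Qs QsP QsI] := adj _ Iy.
  exists (Ps ++ Qs) => [P|z zP].
    rewrite mem_cat => /orP[/PsP|/QsP] [Pp sP]; split=> //;
      exact: subset_trans (@sub_adjoin I _) sP.
  have [|n In] := PsI z; first by move=> P PP; apply: zP; rewrite mem_cat PP.
  have [|m Im] := QsI z; first by move=> P PP; apply: zP; rewrite mem_cat PP orbT.
  by exists (n + m)%N; rewrite exprD; exact: adjoinM In Im.
have [Qs [QsPs QsI inc]] := incomparable_subseq Ps.
have QsP P : P \in Qs -> prime_ideal P /\ I `<=` P by move=> /QsPs/PsP.
have {}QsI x : (forall P, P \in Qs -> P x) -> radical I x.
  by move=> xQ; apply: PsI => P /QsI[Q /xQ Qx]; apply.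
(* If no member of the list were inside [Q], a product of elements of the members would lie outside
   [Q] and yet in the radical of [I]. *)
have above Q : prime_ideal Q -> I `<=` Q -> exists2 P, P \in Qs & P `<=` Q.
  move=> Qp IQ; apply: contrapT => no.
  have [|x Qx xQs] := @prime_avoid_inter Q Qs Qp.
    move=> P PQ; split; first by case: (QsP _ PQ) => [[]].
    by move=> sPQ; apply: no; exists P.
  by apply: Qx; apply: (radical_sub_prime Qp IQ); exact: QsI.
exists Qs; split=> // P; split=> [PQ|[Pp IP Pmin]].
  have [Pp IP] := QsP _ PQ; split=> // Q Qp IQ sQP.
  have [P' P'Q sP'] := above _ Qp IQ; rewrite eqEsubset; split=> //.
  by rewrite -(inc _ _ PQ P'Q (subset_trans sP' sQP)).
have [P' P'Q sP'] := above _ Pp IP; have [P'p IP'] := QsP _ P'Q.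
by rewrite -(Pmin _ P'p IP' sP').
Qed.

Section Minimal.
Hypothesis noeth : noetherian R.
Variables (I : set R) (idI : is_ideal I).

Lemma sup_minimal_prime Q : prime_ideal Q -> I `<=` Q ->
  exists2 P, minimal_primes I P & P `<=` Q.
Proof.
move=> Qp IQ; have [Ps [PsE PsI]] := minimal_primes_finite noeth idI.
apply: contrapT => no; have [|x Qx xPs] := @prime_avoid_inter Q Ps Qp.
  move=> P /PsE Pm; split; first by case: Pm => [[]].
  by move=> sPQ; apply: no; exists P.
by apply: Qx; apply: (radical_sub_prime Qp IQ); exact: PsI.
Qed.

Lemma radical_minimal_primes x :
  (forall P, minimal_primes I P -> P x) -> radical I x.
Proof.
have [Ps [PsE PsI]] := minimal_primes_finite noeth idI.
by move=> xP; apply: PsI => P /PsE; exact: xP.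
Qed.

Lemma ex_minimal_prime : ~ I 1 -> exists P, minimal_primes I P.
Proof.
move=> I1; apply: contrapT => no; apply: I1.
have [|n] := @radical_minimal_primes 1; last by rewrite expr1n.
by move=> P Pm; case: no; exists P.
Qed.

(** Prime avoidance by induction on the list: an [x] that avoids the primes treated so far but lies
    in [P] is corrected by adding some [y] of [J] that lies in all of those primes and outside
    [P]. *)
Lemma minimal_prime_avoidance J : is_ideal J ->
  (forall P, minimal_primes I P -> ~ J `<=` P) -> ~ J `<=` prime_union I.
Proof.
move=> idJ JP; have [Ps [PsE _]] := minimal_primes_finite noeth idI.
suff [x Jx xPs] : exists2 x, J x & forall P, P \in Ps -> ~ P x.
  by move=> /(_ x Jx)[P /PsE]; exact: xPs.
have : forall P, P \in Ps -> minimal_primes I P by move=> P /PsE.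
elim: (Ps) => [|P Qs IH] QsE; first by exists 0 => //; exact: ideal0.
have Qsm Q : Q \in Qs -> minimal_primes I Q.
  by move=> QQ; apply: QsE; rewrite inE QQ orbT.
have [x Jx xQs] := IH Qsm.
have Pm := QsE P (mem_head _ _); have [Pp IP Pmin] := Pm.
have [Px|nPx] := pselect (P x); last first.
  by exists x => // Q; rewrite inE => /predU1P[->|/xQs].
have [|y Py yQs] := @prime_avoid_inter P (J :: Qs) Pp.
  move=> Q; rewrite inE => /predU1P[->|QQ]; first by split=> //; exact: JP.
  have [Qp IQ _] := Qsm _ QQ; split; first exact: prime_is_ideal.
  by move=> sQP; apply: (xQs _ QQ); rewrite (Pmin _ Qp IQ sQP).
exists (x + y); first by apply: idealD => //; apply: yQs; rewrite mem_head.
move=> Q; rewrite inE => /predU1P[->|QQ] Qxy.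
  by apply: Py; rewrite -(addKr x y) addrC; apply: (idealB (prime_is_ideal Pp)).
apply: (xQs _ QQ); rewrite -(addrK y x); have [Qp _ _] := Qsm _ QQ.
apply: (idealB (prime_is_ideal Qp)) => //.
by apply: yQs; rewrite inE QQ orbT.
Qed.

(** Take [x] outside [Q] but in every other minimal prime: then [x] times [Q] lies in all minimal
    primes, hence in the radical ideal [I]. *)
Lemma minimal_prime_colon Q : radical I = I -> minimal_primes I Q ->
  exists2 x, ~ Q x & forall z, Q z <-> I (x * z).
Proof.
move=> radI Qm; have [Qp IQ Qmin] := Qm.
have [Ps [PsE PsI]] := minimal_primes_finite noeth idI.
have [|x Qx xPs] := @prime_avoid_inter Q [seq P <- Ps | P != Q] Qp.
  move=> P; rewrite mem_filter => /andP[/eqP PQ /PsE[Pp IP _]].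
  split; first exact: prime_is_ideal.
  by move=> sPQ; apply: PQ; exact: Qmin.
exists x => // z; split=> [Qz|/IQ]; last by case: Qp => _ _ QM /QM[].
rewrite -radI; apply: PsI => P PP; have [->|PQ] := eqVneq P Q.
  exact: (idealMl (prime_is_ideal Qp)).
have [Pp _ _] := (PsE P).1 PP; apply: (idealMr (prime_is_ideal Pp)).
by apply: xPs; rewrite mem_filter PQ.
Qed.
End Minimal.


Lemma minimal_primes_prime P : prime_ideal P -> minimal_primes P = [set P].
Proof.
move=> Pp; rewrite eqEsubset; split=> [Q [Qp PQ Qmin]|_ ->] /=.
  by rewrite (Qmin P).
by split=> // Q _ PQ QP; rewrite eqEsubset.
Qed.

End IdealBasics.

(** * Determinants modulo an ideal, and Nakayama's lemma *)

Section DeterminantTrick.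
Variables (R : comNzRingType) (I : set R).
Hypothesis idI : is_ideal I.

Lemma det_congr n (A B : 'M[R]_n) :
  (forall i j, I (A i j - B i j)) -> I (\det A - \det B).
Proof.
move=> AB.
have mulP x x' y y' : I (x - x') -> I (y - y') -> I (x * y - x' * y').
  move=> xx yy; rewrite -(subrK (x' * y) (x * y)) -mulrBl -addrA -mulrBr.
  by apply: idealD => //; [exact: idealMr|exact: idealMl].
rewrite /determinant; elim/big_ind2: _ => [|x x' y y' xx yy|s _].
- by rewrite subrr; exact: ideal0.
- by rewrite opprD addrACA; exact: idealD.
- apply: (mulP _ _ _ _ _ _); first by rewrite subrr; exact: ideal0.
  elim/big_ind2: _ => [|x x' y y' xx yy|i _] //.
  + by rewrite subrr; exact: ideal0.
  + exact: mulP.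
Qed.

(** Cramer's rule: multiply the system by the adjugate. *)
Lemma det_annihilates n (A : 'M[R]_n) (y : 'I_n -> R) :
  (forall i, I (\sum_j A i j * y j)) -> forall i, I (\det A * y i).
Proof.
move=> Ay i; suff -> : \det A * y i = \sum_k (\adj A) i k * \sum_j A k j * y j.
  by apply: ideal_sum => // k; exact: idealMl.
under eq_bigr do rewrite mulr_sumr.
rewrite exchange_big /=.
under eq_bigr do (under eq_bigr do rewrite mulrA; rewrite -mulr_suml).
have /matrixP E := mul_adj_mx A.
rewrite (bigD1 i) //= [X in _ + X]big1 ?addr0 => [|j ji].
  by have := E i i; rewrite !mxE eqxx => ->.
by have := E i j; rewrite !mxE eq_sym (negPf ji) => ->; rewrite mul0r.
Qed.
End DeterminantTrick.

Lemma ideal_gen_seq (R : comNzRingType) (gs : seq R) x :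
  ideal_gen [set` gs] x ->
  exists c : 'I_(size gs) -> R, x = \sum_i c i * gs`_i.
Proof.
pose J := [set x | exists c : 'I_(size gs) -> R, x = \sum_i c i * gs`_i].
move=> /(_ J); apply; split=> [|g /= gg].
  split=> [|_ _ [c ->] [d ->]|r _ [c ->]].
  - by exists (fun=> 0); rewrite big1 // => i _; rewrite mul0r.
  - exists (fun i => c i + d i); rewrite -big_split /=.
    by apply: eq_bigr => i _; rewrite mulrDl.
  - exists (fun i => r * c i); rewrite mulr_sumr.
    by apply: eq_bigr => i _; rewrite mulrA.
have lt_g : (index g gs < size gs)%N by rewrite index_mem.
exists (fun i => (i == Ordinal lt_g)%:R).
rewrite (bigD1 (Ordinal lt_g)) //= big1 ?addr0 => [|i /negPf ->].
  by rewrite eqxx mul1r nth_index.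
by rewrite mul0r.
Qed.

(* Nakayama's lemma for the ideal J / Q0 of R / Q0. *)
Lemma idempotent_ideal (R : comNzRingType) (J Q0 : set R) (h : R) :
  noetherian R -> is_ideal J -> prime_ideal Q0 -> Q0 `<=` J -> ~ J `<=` Q0 ->
  (forall x, J x -> exists (K : finType) (u v : K -> R),
     (forall k, J (u k) /\ J (v k)) /\ Q0 (h * x - \sum_k u k * v k)) ->
  exists n, J (h ^+ n).
Proof.
move=> noeth idJ Q0p Q0J nJ hJ; have idQ := prime_is_ideal Q0p.
have [gs JE] := noeth _ idJ.
have Jg (i : 'I_(size gs)) : J gs`_i.
  by rewrite JE => B [_]; apply => /=; exact: mem_nth.
have /choice[Z ZP] (i : 'I_(size gs)) : exists z : 'I_(size gs) -> R,
    (forall j, J (z j)) /\ Q0 (h * gs`_i - \sum_j z j * gs`_j).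
  have [K [u [v [Juv Qx]]]] := hJ _ (Jg i).
  have /choice[c cE] k : exists c : 'I_(size gs) -> R, v k = \sum_j c j * gs`_j.
    by apply: ideal_gen_seq; rewrite -JE; case: (Juv k).
  exists (fun j => \sum_k u k * c k j); split.
    by move=> j; apply: ideal_sum => // k; apply: idealMr => //; case: (Juv k).
  suff -> : \sum_j (\sum_k u k * c k j) * gs`_j = \sum_k u k * v k by [].
  under [RHS]eq_bigr do rewrite cE mulr_sumr.
  rewrite exchange_big /=; apply: eq_bigr => j _; rewrite mulr_suml.
  by apply: eq_bigr => k _; rewrite mulrA.
(* The relations say that [A] kills the vector of generators modulo [Q0]. As the [Z i j] lie in [J],
   [\det A] is congruent to a power of [h] modulo [J]. *)
pose A : 'M[R]_(size gs) := h%:M - \matrix_(i, j) Z i j.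
have QA i : Q0 (\sum_j A i j * gs`_j).
  have [_] := ZP i; congr Q0.
  under [RHS]eq_bigr do rewrite !mxE mulrBl.
  rewrite sumrB; congr (_ - _).
  rewrite (bigD1 i) //= eqxx mulr1n [X in _ + X]big1 ?addr0 // => j ji.
  by rewrite eq_sym (negPf ji) mul0r.
have Qdet := @det_annihilates _ _ idQ _ A (fun j => gs`_j) QA.
exists (size gs); rewrite -det_scalar -(subrK (\det A) (\det _)).
apply: idealD => //.
  apply: det_congr => // i j; rewrite !mxE opprB addrCA subrr addr0.
  by case: (ZP i).
(* [\det A] multiplies [J] into the prime [Q0], and [J] is not inside [Q0], so [\det A] lies in
   [Q0]. *)
apply: Q0J; apply: contrapT => nD; apply: nJ => x; rewrite JE.
move/ideal_gen_seq => [c ->]; apply: ideal_sum => // i; apply: idealMl => //.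
by case: Q0p => _ _ /(_ _ _ (Qdet i))[].
Qed.

(** * Test elements for a single Frobenius-inverse-linear map *)

Section TestElement.
Variables (p : nat) (R : comNzRingType) (chR : p \in [pchar R]) (e : nat).
Local Notation q := (p ^ e)%N.

Lemma frobenius_sum (K : Type) (s : seq K) (F : K -> R) :
  (\sum_(k <- s) F k) ^+ q = \sum_(k <- s) F k ^+ q.
Proof. exact: (raddf_sum (frob chR e)). Qed.

(** Induction on [e]: the coefficients of an expansion over the generators [g i] of [F_* R] are
    expanded over the [h j] of the previous level, which produces the generators
    [h j ^+ p * g i]. *)
Lemma F_finite_iter : F_finite chR -> exists (K : finType) (g : K -> R),
  forall x, exists c : K -> R, x = \sum_k c k ^+ q * g k.
Proof.
case=> n [g gP]; elim: e => [|k [K [h hP]]].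
  exists unit, (fun=> 1) => x; exists (fun=> x).
  by rewrite big_const card_unit /= addr0 mulr1.
exists ('I_n * K)%type, (fun ij => h ij.2 ^+ p * g ij.1) => x.
have [c ->] := gP x.
have /choice[d dP] i := hP (c i).
exists (fun ij => d ij.1 ij.2).
rewrite -(pair_bigA _ (fun i j => d i j ^+ (p ^ k.+1) * (h j ^+ p * g i))) /=.
apply: eq_bigr => i _; rewrite restr_scaleE /=.
have -> : frob chR 1 (c i) = \sum_j d i j ^+ (p ^ k.+1) * h j ^+ p.
  rewrite {1}(dP i) (raddf_sum (frob chR 1)); apply: eq_bigr => j _.
  rewrite -[LHS]/((d i j ^+ (p ^ k) * h j) ^+ (p ^ 1)) expn1.
  by rewrite exprMn -exprM -expnSr.
rewrite [LHS]mulr_suml; by apply: eq_bigr => j _; rewrite mulrA.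
Qed.

Hypotheses (noeth : noetherian R) (Ffin : F_finite chR) (e_gt0 : (0 < e)%N).
Variable phi : pinv_linear chR e.

Let p_gt1 : (1 < p)%N. Proof. exact/prime_gt1/(pcharf_prime chR). Qed.
Let q_gt1 : (1 < q)%N. Proof. by rewrite -(exp1n e) ltn_exp2r. Qed.
Let q_gt0 : (0 < q)%N. Proof. exact: ltnW. Qed.

Lemma pinv_linear0 : phi 0 = 0.
Proof. by apply: (addIr (phi 0)); rewrite -pinv_linearD !add0r. Qed.

Lemma pinv_linear_sum (K : Type) (s : seq K) (F : K -> R) :
  phi (\sum_(k <- s) F k) = \sum_(k <- s) phi (F k).
Proof. exact: (big_morph phi (pinv_linearD phi) pinv_linear0). Qed.

Lemma pinv_linear_pow x : phi (x ^+ q) = x * phi 1.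
Proof. by rewrite -pinv_linearZ mulr1. Qed.

Definition stable (J : set R) : Prop := forall x, J x -> J (phi x).

(** Write [Q] as the colon ideal of [I] by [x]. If [x * z] is in [I], so is [x ^+ q * z], and [phi]
    sends the latter to [x * phi z]. *)
Lemma minimal_prime_stable I Q : is_ideal I -> radical I = I -> stable I ->
  minimal_primes I Q -> stable Q.
Proof.
move=> idI radI stI Qm z.
have [x Qx QE] := minimal_prime_colon noeth idI radI Qm.
rewrite !QE => Ixz; rewrite -pinv_linearZ; apply: stI.
by rewrite -(prednK q_gt0) exprSr -mulrA; exact: idealMl.
Qed.

Section Prime.
Variable Q0 : set R.
Hypotheses (Q0p : prime_ideal Q0) (Q0st : stable Q0) (Q0phi : ~ Q0 (phi 1)).
Let idQ := prime_is_ideal Q0p.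

(** Pairing [z] with [z ^+ q.-1] gives [phi (z ^+ q) = z * phi 1], and [phi 1] is outside the prime
    [Q0]. *)
Lemma trace_form_nondegenerate (K : finType) (g : K -> R) z :
  (forall x, exists c : K -> R, x = \sum_k c k ^+ q * g k) ->
  (forall k, Q0 (phi (z * g k))) -> Q0 z.
Proof.
move=> gen zg.
have zQ x : Q0 (phi (z * x)).
  have [c ->] := gen x; rewrite mulr_sumr pinv_linear_sum.
  by apply: ideal_sum => // k; rewrite mulrCA pinv_linearZ; exact: idealMl.
have := zQ (z ^+ q.-1); rewrite -exprS prednK // pinv_linear_pow.
by case: Q0p => _ _ QM /QM[].
Qed.

(* Modulo Q0, the form (x, y) |-> phi (x y) on F^e_* R is given by a matrix on
   generators; D is a nonzero minor of maximal order of that matrix, and the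
   generators u i of its rows span F^e_* (R / Q0) once D is inverted. *)
Lemma generic_basis : exists (n : nat) (u v : 'I_n -> R),
  let D := \det (\matrix_(i, j) phi (u i * v j)) in
  ~ Q0 D /\ forall x, exists c : 'I_n -> R, Q0 (D ^+ q * x + \sum_i c i ^+ q * u i).
Proof.
have [K [g gen]] := F_finite_iter Ffin.
pose M n (u v : 'I_n -> K) := \matrix_(i, j) phi (g (u i) * g (v j)).
pose minor n := `[< exists u v : 'I_n -> K, ~ Q0 (\det (M n u v)) >].
have minor0 : exists n, minor n.
  exists 0%N; apply/asboolP; have u (i : 'I_0) : K by case: i.
  by exists u, u; rewrite det_mx00; case: Q0p.
(* A minor with a repeated row vanishes, so [u] is injective and the orders of nonzero minors are
   bounded. *)
have bound n : minor n -> (n <= #|K|)%N.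
  move=> /asboolP[u [v nD]]; rewrite -(card_ord n).
  suff /leq_card : injective u by [].
  move=> i j uij; apply: contrapT => /eqP ij; apply: nD.
  rewrite (determinant_alternate ij); first exact: ideal0.
  by move=> k; rewrite !mxE uij.
have [n /asboolP[u [v nD]] nmax] := ex_maxnP minor0 bound.
have big_minor (u' v' : 'I_n.+1 -> K) : Q0 (\det (M _ u' v')).
  apply: contrapT => nD'; have := nmax n.+1; rewrite ltnn => F.
  by have /F : minor n.+1 by apply/asboolP; exists u', v'.
exists n, (g \o u), (g \o v) => D; split; first by [].
(* Border the maximal minor with row [k] and column [l]: the result lies in [Q0]. Its cofactors
   along the new column do not depend on [l], so their [q]-th powers combine the generators into one
   [z] with [phi (z * g l)] in [Q0] for all [l]. The coefficient of [g k] in [z] is [D ^+ q]. *)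
have span k : exists c : 'I_n -> R, Q0 (D ^+ q * g k + \sum_i c i ^+ q * g (u i)).
  pose ext (w : 'I_n -> K) l (i : 'I_n.+1) := oapp w l (unlift ord0 i).
  pose B l := M _ (ext u k) (ext v l).
  pose mu i := cofactor (B k) i ord0.
  have muE l i : cofactor (B l) i ord0 = mu i.
    rewrite /mu /cofactor; congr (_ * \det _); apply/matrixP => a b.
    by rewrite !mxE /ext !liftK.
  pose z := \sum_i mu i ^+ q * g (ext u k i).
  have /(trace_form_nondegenerate gen) : forall l, Q0 (phi (z * g l)).
    move=> l; have := big_minor (ext u k) (ext v l); congr Q0.
    rewrite -/(B l) (expand_det_col _ ord0) /z mulr_suml pinv_linear_sum.
    apply: eq_bigr => i _; rewrite muE mulrC -mulrA pinv_linearZ.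
    by rewrite mxE {2}/ext unlift_none.
  rewrite /z big_ord_recl {1}/ext unlift_none /=.
  have -> : mu ord0 = D.
    rewrite /mu /cofactor addn0 expr0 mul1r; congr (\det _).
    by apply/matrixP => a b; rewrite !mxE /ext !liftK.
  move=> Qz; exists (fun i => mu (lift ord0 i)); move: Qz; congr Q0.
  by congr (_ + _); apply: eq_bigr => i _; rewrite /ext liftK.
move=> x; have [c ->] := gen x.
have /choice[lam lamP] := span.
exists (fun i => \sum_k c k * lam k i).
suff -> : D ^+ q * (\sum_k c k ^+ q * g k) +
    \sum_i (\sum_k c k * lam k i) ^+ q * g (u i) =
    \sum_k c k ^+ q * (D ^+ q * g k + \sum_i lam k i ^+ q * g (u i)).
  by apply: ideal_sum => // k; exact: idealMl.
under [RHS]eq_bigr do rewrite mulrDr mulrCA mulr_sumr.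
rewrite big_split /= mulr_sumr; congr (_ + _); rewrite [RHS]exchange_big /=.
apply: eq_bigr => i _; rewrite frobenius_sum mulr_suml.
by apply: eq_bigr => k _; rewrite exprMn mulrA.
Qed.

(** Expand [x] of [J] over the [u i], multiply by [v j] and apply [phi]: this puts
    [\sum_i c i * A i j] in [J], so Cramer's rule gives [D * c i] in [J]. Hence
    [D ^+ q * D ^+ q * x] is, modulo [Q0], a combination of the [(D * c i) ^+ q], which lie in the
    square of [J], and Nakayama's lemma applies. *)
Lemma generic_test_element : exists2 d, ~ Q0 d &
  forall J, is_ideal J -> stable J -> Q0 `<=` J -> ~ J `<=` Q0 ->
    exists n, J (d ^+ n).
Proof.
have [n [u [v]]] := generic_basis; set A := \matrix_(i, j) _.
move=> [nD span]; set D := \det A in nD span.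
exists D => // J idJ Jst QJ nJQ.
have [|m] := @idempotent_ideal _ J Q0 (D ^+ q * D ^+ q) noeth idJ Q0p QJ nJQ.
  move=> x Jx; have [c Qc] := span x.
  have JDc : forall i, J (D * c i).
    rewrite /D -det_tr; apply: det_annihilates => // j.
    have := idealMr idQ (v j) Qc; rewrite mulrDl -mulrA mulr_suml.
    move=> /Q0st; rewrite pinv_linearD pinv_linearZ pinv_linear_sum => /QJ.
    move=> Jsum; have : J (D * phi (x * v j)).
      by apply: idealMl => //; apply: Jst; exact: idealMr.
    move=> /(idealB idJ Jsum); rewrite addrAC subrr add0r; congr J.
    apply: eq_bigr => i _.
    by rewrite -mulrA pinv_linearZ !mxE mulrC.
  (* Since [q > 1], the power [(D * c i) ^+ q] splits into two factors from [J]. *)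
  exists 'I_n, (fun i => D * c i), (fun i => - ((D * c i) ^+ q.-1 * u i)).
  split=> [i|]; first split=> //.
    apply: idealN => //; apply: idealMr => //; apply: idealX => //.
    by rewrite -ltnS prednK.
  have := idealMl idQ (D ^+ q) Qc; congr Q0.
  rewrite mulrDr mulrA; congr (_ + _); rewrite mulr_sumr -sumrN.
  apply: eq_bigr => i _.
  by rewrite mulrN opprK [RHS]mulrA -exprS prednK // exprMn mulrA.
by rewrite -exprD -exprM; exists ((q + q) * m)%N.
Qed.
End Prime.

Variable P : set R.
Hypotheses (P1 : ~ P 1) (PM : forall x y, ~ P x -> ~ P y -> ~ P (x * y)).
Hypothesis Pphi : ~ P (phi 1).

(** [P] stands for a union of primes, so only its complement is assumed multiplicative. Noetherian
    induction runs over the good primes containing a given [I]. A larger ideal takes over unless [I]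
    is prime and the intersection of the good primes above it, hence stable; then every good prime
    strictly above [I] contains the [d] of [generic_test_element], and [I + Rd] takes over for
    those. *)
Lemma compatible_primes_test_element : exists2 c, ~ P c &
  forall Q, prime_ideal Q -> stable Q -> ~ Q (phi 1) -> ~ Q `<=` P -> Q c.
Proof.
pose good Q := [/\ prime_ideal Q, stable Q, ~ Q (phi 1) & ~ Q `<=` P].
suff H I : is_ideal I ->
    exists2 c, ~ P c & forall Q, good Q -> I `<=` Q -> Q c.
  have [|c Pc cQ] := H [set 0 : R].
    split=> [//|x y /= -> ->|r x /= ->]; [by rewrite addr0|by rewrite mulr0].
  exists c => // Q Qp Qst Qphi QP; apply: cQ => // _ ->.
  exact: ideal0 (prime_is_ideal Qp).
elim/(noetherian_ind noeth) => {}I idI IH.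
have adj x : ~ I x ->
    exists2 c, ~ P c & forall Q, good Q -> I `<=` Q -> Q x -> Q c.
  move=> nx; have [|||c Pc cQ] := IH (adjoin I x).
  - exact: adjoin_is_ideal.
  - exact: sub_adjoin.
  - by move=> /(_ x (mem_adjoin idI x)).
  exists c => // Q Qg IQ Qx; apply: cQ => //; apply: adjoin_min => //.
  by case: Qg => /prime_is_ideal.
have [[x [y [Ixy Ix Iy]]]|nprod] :=
    pselect (exists x y, [/\ I (x * y), ~ I x & ~ I y]).
  have [c Pc cQ] := adj x Ix; have [d Pd dQ] := adj y Iy.
  exists (c * d) => [|Q Qg IQ]; first exact: PM.
  have [Qp _ _ _] := Qg; have idQ := prime_is_ideal Qp.
  have [_ _ QM] := Qp; have [Qx|Qy] := QM _ _ (IQ _ Ixy).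
    by apply: idealMr => //; exact: cQ.
  by apply: idealMl => //; exact: dQ.
have [[x Ix xQ]|full] :=
    pselect (exists2 x, ~ I x & forall Q, good Q -> I `<=` Q -> Q x).
  have [c Pc cQ] := adj x Ix; exists c => // Q Qg IQ.
  by apply: cQ => //; exact: xQ.
have {}full x : (forall Q, good Q -> I `<=` Q -> Q x) -> I x.
  by move=> xQ; apply: contrapT => Ix; apply: full; exists x.
have [Iphi|nIphi] := pselect (I (phi 1)).
  by exists 1 => // Q [_ _ nQ _] /(_ _ Iphi).
have I1 : ~ I 1.
  by move=> I1; apply: nIphi; rewrite -[phi 1]mulr1; exact: idealMl.
have Ip : prime_ideal I.
  split=> // x y Ixy; apply: contrapT => /not_orP[nx ny].
  by apply: nprod; exists x, y.
have Ist : stable I.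
  by move=> x Ix; apply: full => Q [_ Qst _ _] IQ; exact/Qst/IQ.
have [d nd dJ] := generic_test_element Ip Ist nIphi.
have [c Pc cQ] := adj d nd.
have {}cQ Q : good Q -> I `<=` Q -> ~ Q `<=` I -> Q c.
  move=> Qg IQ QI; apply: (cQ) => //; have [Qp Qst _ _] := Qg.
  by have [n] := dJ Q (prime_is_ideal Qp) Qst IQ QI; exact: prime_exp.
(* What remains is [Q = I]: it is not good if [I] is inside [P], and otherwise an element [y] of [I]
   outside [P] covers it. *)
have [IP|/existsNP[y /not_implyP[Iy Py]]] := pselect (I `<=` P).
  exists c => // Q Qg IQ; apply: cQ => // QI.
  by have [_ _ _ []] := Qg; exact: subset_trans IP.
exists (c * y) => [|Q Qg IQ]; first exact: PM.
have [Qp _ _ _] := Qg; apply: (idealMl (prime_is_ideal Qp)); exact: IQ.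
Qed.

Lemma test_element : exists2 t, ~ P t &
  forall J, is_ideal J -> stable J -> ~ J `<=` P -> J t.
Proof.
have [c Pc cQ] := compatible_primes_test_element.
have Pg := Pphi; set g := phi 1 in Pg cQ; pose d := g * c.
have Pd : ~ P d by exact: PM.
exists (d ^+ 3) => [|J idJ Jst JP]; first by apply: PM => //; exact: PM.
(* [K] is the saturation of [J] by [g]; it absorbs the factor [phi 1 = g] that appears when [phi] is
   applied to a [q]-th power. *)
pose K : set R := [set x | exists n, J (g ^+ n * x)].
have JK : J `<=` K by move=> x Jx; exists 0%N; rewrite mul1r.
have idK : is_ideal K.
  split=> [|x y [n Jx] [m Jy]|r x [n Jx]].
  - by exists 0%N; rewrite mulr0; exact: ideal0.
  - exists (n + m)%N; rewrite mulrDr; apply: idealD => //.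
      by rewrite addnC exprD -mulrA; exact: idealMl.
    by rewrite exprD -mulrA; exact: idealMl.
  - by exists n; rewrite mulrCA; exact: idealMl.
have pow_up n x : J (g ^+ n * x) -> J ((g ^+ n) ^+ q * x).
  by move=> Jx; rewrite -(prednK q_gt0) exprSr -mulrA; exact: idealMl.
have Kst : stable K.
  move=> x [n Jx]; exists n; rewrite -pinv_linearZ.
  by apply: Jst; exact: pow_up.
have Kq x : K (x ^+ q) -> K x.
  move=> [n /pow_up Jx]; exists n.+1.
  move: Jx => /Jst; rewrite pinv_linearZ pinv_linear_pow -/g.
  by rewrite exprSr -mulrA [x * g]mulrC.
have Kqn n x : K (x ^+ (q ^ n)) -> K x.
  by elim: n => [//|n IH]; rewrite expnSr exprM => /Kq.
have radK : radical K = K.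
  rewrite eqEsubset; split; last exact: sub_radical.
  move=> x [n Kx]; apply: (Kqn n).
  by rewrite -(subnK (ltnW (ltn_expl n q_gt1))) exprD; exact: idealMl.
(* The minimal primes of [K] are stable, omit [g] by saturation, and are not inside [P] as they
   contain [J]; so all of them contain [c]. *)
have [n Jc] : K c.
  rewrite -radK; apply: radical_minimal_primes => // Q Qm.
  have [Qp KQ _] := Qm; apply: cQ => //.
  - exact: minimal_prime_stable Qm.
  - have [x Qx QE] := minimal_prime_colon noeth idK radK Qm.
    move=> /QE[n Jn]; apply: Qx; apply: KQ; exists n.+1.
    by rewrite exprSr -mulrA [g * x]mulrC.
  - by move=> QP; apply: JP; apply: subset_trans QP; exact: subset_trans KQ.
(* With [h] the upper half of [m], [d ^+ (h * q) * c ^+ q] is in [J] because [m <= h * q], and [phi]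
   sends it to [d ^+ h * c * g = d ^+ h.+1]. The exponent [h.+1] is smaller than [m] exactly when
   [m > 3]. *)
have /(_ n.+1) : forall m, J (d ^+ m) -> J (d ^+ 3).
  elim/ltn_ind => m IH Jm.
  have [m3|m3] := leqP m 3.
    by rewrite -(subnK m3) exprD; exact: idealMl.
  apply: (IH (uphalf m).+1); first by rewrite uphalfE -divn2; lia.
  have -> : d ^+ (uphalf m).+1 = phi ((d ^+ uphalf m) ^+ q * c ^+ q).
    by rewrite pinv_linearZ pinv_linear_pow -/g exprSr [c * g]mulrC.
  apply: Jst; apply: idealMr => //; rewrite -exprM.
  have mq : (m <= uphalf m * q)%N.
    have : (uphalf m * 2 <= uphalf m * q)%N by rewrite leq_mul2l q_gt1 orbT.
    by apply: leq_trans; rewrite muln2 uphalfE -divn2; lia.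
  by rewrite -(subnK mq) exprD; exact: idealMl.
apply; rewrite exprMn exprS exprSr mulrACA; exact: idealMl.
Qed.
End TestElement.

(** * Trace ideals and the existence of adjoint ideals *)

Section CartierIdeals.
Variables (p : nat) (R : comNzRingType) (chR : p \in [pchar R]).
Variables (C : cartier_algebra p R) (alpha : cartier_action chR C).

Lemma trace_ideal_is_ideal e : is_ideal (trace_ideal alpha e).
Proof.
split=> [|_ _ [n [k [x ->]]] [m [l [y ->]]]|r _ [n [k [x ->]]]].
- by exists 0%N, (fun=> 0), (fun=> 0); rewrite big_ord0.
- exists (n + m)%N,
    (fun i => match fintype.split i with inl j => k j | inr j => l j end),
    (fun i => match fintype.split i with inl j => x j | inr j => y j end).
  rewrite big_split_ord /=; congr (_ + _); apply: eq_bigr => i _.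
    by rewrite (unsplitK (inl i)).
  by rewrite (unsplitK (inr i)).
- exists n, k, (fun i => r ^+ (p ^ e) * x i).
  by rewrite mulr_sumr; apply: eq_bigr => i _; rewrite pinv_linearZ.
Qed.

Lemma mem_trace_ideal e (k : C e) x : trace_ideal alpha e (act_map alpha k x).
Proof. by exists 1%N, (fun=> k), (fun=> x); rewrite big_ord1. Qed.

Lemma prime_union1 (I : set R) : ~ prime_union I 1.
Proof. by case=> P [[_ P1 _] _ _]. Qed.

Lemma prime_unionM (I : set R) x y :
  ~ prime_union I x -> ~ prime_union I y -> ~ prime_union I (x * y).
Proof.
by move=> nx ny [P Pm]; have [[_ _ PM] _ _] := Pm;
  case/PM => [Px|Py]; [apply: nx|apply: ny]; exists P.
Qed.

Lemma adjoint_ideal_exists (I : set R) : noetherian R -> F_finite chR ->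
  nondegenerate_wrt alpha I -> exists t, is_adjoint_ideal alpha I t.
Proof.
move=> noeth Ffin [e e_gt0] /existsNP[y /not_implyP[[n [k [x ->]]] ny]].
(* An element of the trace ideal is a sum of values of several maps; summing their premultiples
   gives a single map with that sum as its value at [1], and every compatible ideal is stable under
   it. *)
pose g z := \sum_(i < n) act_map alpha (k i) (x i * z).
have gD u v : g (u + v) = g u + g v.
  by rewrite /g -big_split; apply: eq_bigr => i _; rewrite mulrDr pinv_linearD.
have gZ r u : g (r ^+ (p ^ e) * u) = r * g u.
  rewrite /g mulr_sumr; apply: eq_bigr => i _.
  by rewrite mulrCA pinv_linearZ.
pose phi : pinv_linear chR e := pinv_build chR gD gZ.
have phi1 : ~ prime_union I (phi 1).
  rewrite pinv_buildE /g; under eq_bigr do rewrite mulr1; exact: ny.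
have [t nt tJ] := @test_element p R chR e noeth Ffin e_gt0 phi (prime_union I)
  (@prime_union1 I) (@prime_unionM I) phi1.
exists [set z | forall J, cartier_submodule alpha J -> ~ J `<=` prime_union I -> J z].
split=> [||J cJ JI z]; last exact.
- split=> [|d l z zJ J cJ JI]; last by have [_ stJ] := cJ; apply: stJ; exact: zJ.
  split=> [J [idJ _] _|u v uJ vJ J cJ JI|r u uJ J cJ JI].
  + exact: ideal0.
  + by have [idJ _] := cJ; apply: idealD => //; [exact: uJ|exact: vJ].
  + by have [idJ _] := cJ; apply: idealMl => //; exact: uJ.
- move=> /(_ t) tI; apply/nt/tI => J [idJ stJ] JI; apply: tJ => // z Jz.
  by apply: ideal_sum => // i; apply: stJ; exact: idealMl.
Qed.

Lemma not_sub_prime_union (I J : set R) : noetherian R -> is_ideal I -> is_ideal J ->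
  ~ J `<=` prime_union I <-> forall P, minimal_primes I P -> ~ J `<=` P.
Proof.
move=> noeth idI idJ; split=> [JI P Pm JP|]; last exact: minimal_prime_avoidance.
by apply: JI => x /JP Px; exists P.
Qed.
End CartierIdeals.

(** * Transfer of compatible ideals between [R] and [S] along [T] *)

Section Transfer.
Variables (p : nat) (R S : comNzRingType).
Variables (chR : p \in [pchar R]) (chS : p \in [pchar S]).
Variables (f : {rmorphism R -> S}) (T : linhom (restr f S^o) R^o).
Hypothesis nT : nondegenerate_form T.
Variables (C : cartier_algebra p R) (alpha : cartier_action chR C).
Hypothesis tr : action_transposable chS T alpha.
Local Notation beta := (pullback_action nT tr).

(** For an ideal [J], this is the largest ideal of [S] that [T] maps into [J]. *)
Definition pairing_ideal (J : set R) : set S :=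
  [set s : S | forall t : S, J (T (s * t))].

(** A common form for the minimal primes of [b] and, when [a] is prime, the primes over [a]; the
    transfer arguments use only this relation. *)
Definition linked (Q : set S) (P : set R) : Prop :=
  exists2 x : S, ~ Q x & forall z, Q z <-> pairing_ideal P (x * z).

Lemma T0 : T 0 = 0.
Proof. by apply: (addIr (T 0)); rewrite -T_additive !add0r. Qed.

Lemma act_T e (k : C e) s :
  act_map alpha k (T s) = T (act_map beta (ptensor f k 1) s).
Proof.
rewrite (transposeP (tr k) s) [in RHS]/act_map /=.
by rewrite pullback_actE mul1r.
Qed.

Lemma act_pullbackD e (u v : pullback chS f C e) x :
  act_map beta (u + v) x = act_map beta u x + act_map beta v x.
Proof. by rewrite /act_map chomD. Qed.

(** By additivity take [v] to be a pure tensor of [k] and [u]; moving [t] inside the transpose as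
    [t ^+ (p ^ e)] turns the left side into [k] applied to a value of [T] on a multiple of [s]. *)
Lemma T_act_pullback (J : set R) e (v : pullback chS f C e) s t : is_ideal J ->
  (forall (k : C e) u, J (act_map alpha k (T (s * u)))) ->
  J (T (act_map beta v s * t)).
Proof.
move=> idJ Jk; elim/pullback_ind: v => [|k u v IH].
  have -> : act_map beta (0 : pullback chS f C e) s = 0.
    apply: (addIr (act_map beta (0 : pullback chS f C e) s)).
    by rewrite -act_pullbackD !add0r.
  by rewrite mul0r T0; exact: ideal0.
rewrite act_pullbackD mulrDl T_additive; apply: idealD => //.
rewrite [act_map _ _ _]pullback_actE mulrC -pinv_linearZ.
rewrite -(transposeP (tr k)) mulrA mulrC; exact: Jk.
Qed.

Lemma pairing_is_ideal J : is_ideal J -> is_ideal (pairing_ideal J).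
Proof.
move=> idJ; split=> [t|x y Jx Jy t|r x Jx t].
- by rewrite mul0r T0; exact: ideal0.
- by rewrite mulrDl T_additive; apply: idealD => //.
- by rewrite mulrAC mulrC; exact: Jx.
Qed.

Lemma pairing_cartier_submodule J :
  cartier_submodule alpha J -> cartier_submodule beta (pairing_ideal J).
Proof.
move=> [idJ stJ]; split=> [|e v s Js t]; first exact: pairing_is_ideal.
by apply: T_act_pullback => // k u; exact: stJ.
Qed.

Lemma image_cartier_submodule J :
  cartier_submodule beta J -> cartier_submodule alpha (T @` J).
Proof.
move=> [idJ stJ]; split.
  split=> [|_ _ [x Jx <-] [y Jy <-]|r _ [x Jx <-]].
  - by exists 0; [exact: ideal0|exact: T0].
  - by exists (x + y); [exact: idealD|exact: T_additive].
  - by exists (f r * x); [exact: idealMl|exact: T_scale].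
move=> e k _ [x Jx <-]; rewrite act_T; eexists; last by [].
exact: stJ.
Qed.

(** [f r] is in [Q] iff [r * T (x * t)] is in [P] for all [t], and some [T (x * t)] is outside [P]
    because [1] is outside [Q]. *)
Lemma linked_lies_over Q P : prime_ideal Q -> prime_ideal P -> linked Q P ->
  lies_over f Q P.
Proof.
move=> [_ Q1 _] Pp [x Qx QE]; have idP := prime_is_ideal Pp.
rewrite /lies_over eqEsubset; split=> r /=; rewrite QE => Pr.
  apply: contrapT => nr; apply: Q1; apply/QE => t.
  have := Pr t; rewrite mulr1 mulrAC mulrC T_scale.
  by case: Pp => _ _ PM /PM[].
by move=> t; rewrite mulrAC mulrC T_scale; exact: idealMr.
Qed.

Lemma linked_image Q P J : linked Q P -> is_ideal J ->
  ~ J `<=` Q -> ~ T @` J `<=` P.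
Proof.
move=> [x _ QE] idJ JQ JP; apply: JQ => y Jy; apply/QE => t; apply: JP.
by exists (x * y * t) => //; apply: idealMr => //; exact: idealMl.
Qed.

(** [f] maps [J] into [pairing_ideal J], and [Q] contracts to [P]. *)
Lemma linked_pairing Q P J : prime_ideal Q -> prime_ideal P -> linked Q P ->
  is_ideal J -> ~ J `<=` P -> ~ pairing_ideal J `<=` Q.
Proof.
move=> Qp Pp /(linked_lies_over Qp Pp) <- idJ JP JQ; apply: JP => r Jr.
by apply: JQ => t; rewrite T_scale; exact: idealMr.
Qed.

Lemma linked_trace Q P e : prime_ideal Q -> prime_ideal P -> linked Q P ->
  trace_ideal alpha e `<=` P <-> trace_ideal beta e `<=` Q.
Proof.
move=> Qp Pp [x Qx QE].
have idP := prime_is_ideal Pp; have idQ := prime_is_ideal Qp.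
split=> [CP _ [n [v [y ->]]]|CQ _ [n [k [r ->]]]]; apply: ideal_sum => // i.
  apply/QE => t; rewrite mulrAC mulrC; apply: T_act_pullback => // k u.
  exact/CP/mem_trace_ideal.
(* Otherwise [x ^+ (p ^ e)] would lie in [Q]. The resulting [c] makes [c ^+ (p ^ e) * r i] a value
   of [T] at a multiple of [x ^+ (p ^ e)]; the transpose then releases a factor [x], which carries
   [Q] into [pairing_ideal P]. *)
have [t Pt] : exists t, ~ P (T (x * x ^+ (p ^ e) * t)).
  apply/existsNP => Pt; apply: Qx; apply: (prime_exp (n := p ^ e)) => //.
  exact/QE.
set c := T _ in Pt; pose s := f (c ^+ (p ^ e).-1 * r i) * (x * t).
have [_ _ PM] := Pp; have /PM[] // : P (c * act_map alpha (k i) (r i)).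
rewrite -(pinv_linearZ (act_map alpha (k i))); have p_gt0 : (0 < p ^ e)%N.
  by rewrite expn_gt0 prime_gt0 // (pcharf_prime chR).
have -> : c ^+ (p ^ e) * r i = T (x ^+ (p ^ e) * s).
  rewrite /s mulrCA T_scale mulrA [x ^+ _ * x]mulrC -/c.
  by rewrite mulrAC -exprSr prednK.
rewrite act_T pinv_linearZ -[_ * _]mulr1.
have : Q (act_map beta (ptensor f (k i) 1) s) by exact/CQ/mem_trace_ideal.
by move/QE; apply.
Qed.

(** * Adjoint ideals when the minimal primes on both sides are linked *)

Section MinimalPrimes.
Hypotheses (noethR : noetherian R) (noethS : noetherian S).
Variables (I : set R) (J : set S).
Hypotheses (idI : is_ideal I) (idJ : is_ideal J).
Hypothesis below : forall Q, minimal_primes J Q ->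
  exists2 P, minimal_primes I P & linked Q P.
Hypothesis above : forall P, minimal_primes I P ->
  exists2 Q, minimal_primes J Q & linked Q P.

Lemma nondegenerate_transfer :
  nondegenerate_wrt alpha I <-> nondegenerate_wrt beta J.
Proof.
split=> -[e e_gt0 He]; exists e => //; move: He;
  rewrite !not_sub_prime_union //; try exact: trace_ideal_is_ideal.
- move=> CP Q Qm; have [P Pm QP] := below Qm.
  have [Qp _ _] := Qm; have [Pp _ _] := Pm.
  by rewrite -(linked_trace e Qp Pp QP); exact: CP.
- move=> CQ P Pm; have [Q Qm QP] := above Pm.
  have [Qp _ _] := Qm; have [Pp _ _] := Pm.
  by rewrite (linked_trace e Qp Pp QP); exact: CQ.
Qed.

Lemma image_not_sub K : is_ideal K -> is_ideal (T @` K) ->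
  ~ K `<=` prime_union J -> ~ T @` K `<=` prime_union I.
Proof.
move=> idK idTK; rewrite !not_sub_prime_union // => KQ P Pm.
have [Q Qm QP] := above Pm; apply: (linked_image QP) => //; exact: KQ.
Qed.

Lemma pairing_not_sub K : is_ideal K ->
  ~ K `<=` prime_union I -> ~ pairing_ideal K `<=` prime_union J.
Proof.
move=> idK; have idTK := pairing_is_ideal idK.
rewrite !not_sub_prime_union // => KP Q Qm.
have [P Pm QP] := below Qm; have [Qp _ _] := Qm; have [Pp _ _] := Pm.
by apply: (linked_pairing Qp Pp QP) => //; exact: KP.
Qed.

Lemma adjoint_ideal_transfer t u :
  is_adjoint_ideal alpha I t -> is_adjoint_ideal beta J u -> T @` u = t.
Proof.
move=> [ct tI tmin] [cu uJ umin].
have cTu := image_cartier_submodule cu; have cKt := pairing_cartier_submodule ct.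
rewrite eqEsubset; split.
  move=> _ [s us <-]; rewrite -[s]mulr1.
  have : pairing_ideal t s.
    by apply: umin => //; apply: pairing_not_sub => //; case: ct.
  exact.
apply: tmin => //; apply: image_not_sub => //; first by case: cu.
by case: cTu.
Qed.

Lemma purely_F_regular_surjective :
  purely_F_regular alpha I -> range T = setT.
Proof.
move=> [_ _ min]; rewrite eqEsubset; split=> //; apply: min.
  by apply: image_cartier_submodule; split=> //; exact: ideal_setT.
have cT : cartier_submodule beta (@setT S) by split=> //; exact: ideal_setT.
apply: image_not_sub; first exact: ideal_setT.
  by have [] := image_cartier_submodule cT.
by move=> /(_ 1 Logic.I); exact: prime_union1.
Qed.

Lemma purely_F_regular_descends :
  purely_F_regular beta J -> range T = setT -> purely_F_regular alpha I.
Proof.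
move=> [_ _ min] Tsurj; split.
- by split=> //; exact: ideal_setT.
- by move=> /(_ 1 Logic.I); exact: prime_union1.
- move=> K cK KI r _; have : range T r by rewrite Tsurj.
  move=> [s _ <-]; rewrite -[s]mulr1.
  suff : pairing_ideal K s by exact.
  apply: min => //; first exact: pairing_cartier_submodule.
  by apply: pairing_not_sub => //; case: cK.
Qed.
End MinimalPrimes.
End Transfer.

(** * Lying over, integrality and incomparability for finite morphisms *)

Section FiniteMorphism.
Variables (R S : comNzRingType) (f : {rmorphism R -> S}).
Hypothesis fin_f : finite_morphism f.

Lemma finite_morphism_gens : exists (n : nat) (g : 'I_n -> S),
  forall s, exists c : 'I_n -> R, s = \sum_i f (c i) * g i.
Proof. exact: fin_f. Qed.

Lemma zero_ideal : is_ideal [set 0 : S].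
Proof. by split=> [//|x y /= -> ->|r x /= ->]; rewrite ?addr0 ?mulr0. Qed.

Lemma finite_annihilator n (g : 'I_n -> S) (A : 'M[S]_n) :
  (forall s, exists c : 'I_n -> R, s = \sum_i f (c i) * g i) ->
  (forall i, \sum_j A i j * g j = 0) -> \det A = 0.
Proof.
move=> gen Ag; have [c c1] := gen 1; rewrite -[\det A]mulr1 c1 mulr_sumr.
apply: big1 => i _; rewrite mulrCA.
by rewrite [_ * g i](det_annihilates zero_ideal Ag) mulr0.
Qed.

(** If [PS = S], expressing the generators with coefficients in [P] yields a matrix over [R] that is
    congruent to the identity modulo [P] and whose determinant kills [S]; by injectivity that
    determinant is [0], so [1] lies in [P]. *)
Lemma extend_proper P : injective f -> is_ideal P -> ~ P 1 -> ~ extend f P 1.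
Proof.
move=> finj idP P1 eP1; have [n [g gen]] := finite_morphism_gens.
pose E : set S :=
  [set s | exists2 c : 'I_n -> R, (forall i, P (c i)) & s = \sum_i f (c i) * g i].
have fE r s : P r -> E (f r * s).
  move=> Pr; have [d ->] := gen s; exists (fun i => r * d i) => [i|].
    exact: idealMr.
  by rewrite mulr_sumr; apply: eq_bigr => i _; rewrite rmorphM mulrA.
have idE : is_ideal E.
  have E0 : E 0.
    exists (fun=> 0) => [_|]; first exact: ideal0.
    by rewrite big1 // => i _; rewrite rmorph0 mul0r.
  have ED x y : E x -> E y -> E (x + y).
    move=> [c Pc ->] [d Pd ->]; exists (fun i => c i + d i) => [i|].
      exact: idealD.
    by rewrite -big_split; apply: eq_bigr => i _; rewrite rmorphD mulrDl.
  split=> // s _ [c Pc ->]; rewrite mulr_sumr; elim/big_ind: _ => // i _.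
  by rewrite mulrCA; exact: fE.
have E1 : E 1 by apply: (extend_sub idE) eP1 => r Pr; rewrite /= -[f r]mulr1; exact: fE.
have /choice[c cP] i : exists c : 'I_n -> R,
    (forall j, P (c j)) /\ g i = \sum_j f (c j) * g j.
  by have := idealMl idE (g i) E1; rewrite mulr1 => -[c Pc gi]; exists c.
pose A : 'M[R]_n := 1%:M - \matrix_(i, j) c i j.
have detA : \det A = 0.
  apply: finj; rewrite rmorph0 -det_map_mx; apply: (finite_annihilator gen) => i.
  have [_ gi] := cP i.
  under eq_bigr do rewrite !mxE rmorphB mulrBl.
  rewrite sumrB -gi (bigD1 i) //= eqxx rmorph1 mul1r big1 ?addr0 ?subrr // => j ji.
  by rewrite eq_sym (negPf ji) rmorph0 mul0r.
apply: P1; rewrite -(det1 R n) -[\det _]subr0 -detA; apply: det_congr => // i j.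
by rewrite !mxE opprB addrCA subrr addr0; case: (cP i).
Qed.

(** Cayley-Hamilton for multiplication by [s] on the generators. *)
Lemma finite_integral s : exists2 u : {poly R}, u \is monic & (map_poly f u).[s] = 0.
Proof.
have [n [g gen]] := finite_morphism_gens.
have /choice[c cP] i := gen (s * g i).
pose A : 'M[R]_n := \matrix_(i, j) c i j.
exists (char_poly A); first exact: char_poly_monic.
rewrite map_char_poly /char_poly -horner_evalE -det_map_mx.
apply: (finite_annihilator gen) => i.
under eq_bigr do rewrite !mxE /= horner_evalE hornerD hornerN hornerMn hornerX hornerC
  mulrBl.
rewrite sumrB -cP (bigD1 i) //= eqxx mulr1n big1 ?addr0 ?subrr // => j ji.
by rewrite eq_sym (negPf ji) mul0r.
Qed.

(** For [s] in [Q] outside [P], take an integral equation modulo [P]. Its constant term lies in [Q],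
    hence in [P], so a factor [s] can be cancelled; repeating this leaves the leading coefficient
    [1] in [P]. *)
Lemma finite_incomparable (P Q : set S) : prime_ideal P -> prime_ideal Q ->
  P `<=` Q -> f @^-1` Q `<=` f @^-1` P -> Q `<=` P.
Proof.
move=> Pp Qp PQ QP s Qs; apply: contrapT => nPs.
have idP := prime_is_ideal Pp; have idQ := prime_is_ideal Qp.
have [u umon us] := finite_integral s.
have : P (map_poly f u).[s] by rewrite us; exact: ideal0.
elim/poly_ind: u umon {us} => [|u c IH].
  by rewrite monicE lead_coef0 eq_sym oner_eq0.
have [->|u0] := eqVneq u 0.
  rewrite mul0r add0r monicE lead_coefC => /eqP ->.
  by rewrite map_polyC hornerC /= rmorph1; case: Pp.
rewrite monicE lead_coefDl ?lead_coefMX => [umon|]; last first.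
  by rewrite size_mulX // size_polyC ltnS (leq_trans (leq_b1 _)) // size_poly_gt0.
rewrite rmorphD rmorphM /= map_polyX map_polyC hornerD hornerM hornerX hornerC.
move=> Pu; have Pc : P (f c).
  apply: QP; rewrite /= -(addKr ((map_poly f u).[s] * s) (f c)) addrC.
  by apply: (idealB idQ) (PQ _ Pu) _; exact: idealMl.
apply: IH => //; have : P ((map_poly f u).[s] * s).
  by rewrite -[_ * s](addrK (f c)); exact: idealB.
by case: Pp => _ _ PM /PM[].
Qed.

End FiniteMorphism.

(** * Minimal primes of the extended ideal under the condition on [T] *)

Section Branches.
Variables (R S : comNzRingType) (f : {rmorphism R -> S}).
Variable T : linhom (restr f S^o) R^o.
Hypotheses (fin_f : finite_morphism f) (inj_f : injective f).
Hypotheses (noethR : noetherian R) (noethS : noetherian S).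
Variable a : set R.
Hypothesis a_ideal : is_ideal a.
Hypothesis star : forall P, minimal_primes a P ->
  radical (extend f P) = pairing_ideal T P.

Let rad_ideal (I : set R) : is_ideal (radical (extend f I)).
Proof. exact/radical_is_ideal/extend_is_ideal. Qed.

Lemma extend_mono (I J : set R) : I `<=` J -> extend f I `<=` extend f J.
Proof.
by move=> IJ; apply: extend_sub (extend_is_ideal _ _) _ => r /IJ; exact: sub_extend.
Qed.

Lemma radical_extend_mono (I J : set R) : I `<=` J ->
  radical (extend f I) `<=` radical (extend f J).
Proof. by move=> /extend_mono IJ s [n /IJ ?]; exists n. Qed.

Lemma radical_extend_sub (I : set R) Q : prime_ideal Q -> I `<=` f @^-1` Q ->
  radical (extend f I) `<=` Q.
Proof.
move=> Qp IQ; apply: radical_sub_prime => //.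
exact: extend_sub (prime_is_ideal Qp) IQ.
Qed.

Lemma sub_preimage_radical_extend (I : set R) Q :
  radical (extend f I) `<=` Q -> I `<=` f @^-1` Q.
Proof. by move=> IQ r Ir; apply: IQ; apply: sub_radical; exact: sub_extend. Qed.

Lemma minimal_linked P Q : minimal_primes a P ->
  minimal_primes (radical (extend f P)) Q -> linked T Q P.
Proof.
move=> Pm Qm; rewrite /linked -(star Pm).
exact: (minimal_prime_colon noethS (rad_ideal P) (radicalK _) Qm).
Qed.

(** The contraction of [Q] contains a minimal prime [P] of [a], and [Q] is then also minimal over
    the radical of [PS]. *)
Lemma minimal_prime_below Q : minimal_primes (radical (extend f a)) Q ->
  exists2 P, minimal_primes a P & linked T Q P.
Proof.
move=> [Qp aQ Qmin].
have [P Pm PQ] := sup_minimal_prime noethR a_ideal (preimage_prime f Qp)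
  (sub_preimage_radical_extend aQ).
exists P => //; apply: minimal_linked => //; have [_ aP _] := Pm.
split=> // [|Q' Q'p PQ']; first exact: radical_extend_sub.
by apply: Qmin => //; apply: subset_trans PQ'; exact: radical_extend_mono.
Qed.

(** Take [Q] minimal over [PS]. A prime inside [Q] that contains [aS] contracts to a prime between
    [a] and [P], hence to [P], so it contains [PS] and equals [Q]. *)
Lemma minimal_prime_above P : minimal_primes a P ->
  exists2 Q, minimal_primes (radical (extend f a)) Q & linked T Q P.
Proof.
move=> Pm; have [Pp aP Pmin] := Pm.
have [|Q Qm] := ex_minimal_prime noethS (rad_ideal P).
  move=> [n]; rewrite expr1n; apply: extend_proper => //.
    exact: prime_is_ideal.
  by case: Pp.
have QP := minimal_linked Pm Qm; have [Qp PQ Qmin] := Qm.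
exists Q => //; split=> // [|Q' Q'p aQ' Q'Q].
  by apply: subset_trans PQ; exact: radical_extend_mono.
apply: Qmin => //; apply: radical_extend_sub => //.
rewrite (Pmin (f @^-1` Q')) //; first exact: preimage_prime.
  exact: sub_preimage_radical_extend.
by rewrite -(linked_lies_over Qp Pp QP) => r; exact: Q'Q.
Qed.

(** Reduces the compatibility of [b] to that of pairing ideals, by testing both sides on minimal
    primes. *)
Lemma radical_extendE : radical a = a -> radical (extend f a) = pairing_ideal T a.
Proof.
move=> rada; rewrite eqEsubset; split=> s.
  move=> sa t; rewrite -rada; apply: radical_minimal_primes => // P Pm.
  have [_ aP _] := Pm.
  have : pairing_ideal T P s by rewrite -star //; exact: radical_extend_mono sa.
  exact.
move=> sa; apply: radical_minimal_primes => //; first exact: extend_is_ideal.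
move=> Q [Qp aQ _].
have [|P Pm PQ] := sup_minimal_prime noethR a_ideal (preimage_prime f Qp).
  by move=> r ar; apply: aQ; exact: sub_extend.
have [_ aP _] := Pm; apply: (radical_extend_sub Qp PQ).
by rewrite star // => t; apply: aP; exact: sa.
Qed.

Lemma prime_over_linked Q : prime_ideal a -> prime_ideal Q ->
  lies_over f Q a -> linked T Q a.
Proof.
move=> ap Qp Qa; apply: minimal_linked; first by rewrite minimal_primes_prime.
split=> // [|Q' Q'p aQ' Q'Q].
  by apply: radical_extend_sub => //; rewrite -Qa.
rewrite eqEsubset; split=> //; apply: (finite_incomparable fin_f) => //.
by rewrite Qa; exact: sub_preimage_radical_extend.
Qed.

End Branches.

Theorem theorem5p12 (p : nat) (R S : idomainType)
    (chR : p \in [pchar R]) (chS : p \in [pchar S])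
    (noethR : noetherian R) (noethS : noetherian S)
    (FfinR : F_finite chR) (FfinS : F_finite chS)
    (f : {rmorphism R -> S}) (fin_f : finite_morphism f) (dom_f : dominant f)
    (a : set R) (a_ideal : is_ideal a) (a_proper : a <> setT)
    (a_radical : radical a = a)
    (sigma : {linear S^o -> omega f})
    (sigma_iso : generic_iso f sigma)
    (star : forall P : set R, minimal_primes a P ->
       radical (extend f P) = [set s : S | forall t : S, P (sigma 1 (s * t))])
    (C : cartier_algebra p R) (alpha : cartier_action chR C)
    (C_tr : action_transposable chS (sigma 1) alpha)
    (a_compat : cartier_submodule alpha a) :
  let b : set S := radical (extend f a) in
  let T : S -> R := sigma 1 in
  let beta : cartier_action chS (pullback chS f C) :=
    pullback_action (generic_iso_nondegenerate dom_f sigma_iso) C_tr in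
  [/\ cartier_submodule beta b,
      (nondegenerate_wrt alpha a <-> nondegenerate_wrt beta b) /\
      (nondegenerate_wrt alpha a -> exists ta tb,
         [/\ is_adjoint_ideal alpha a ta, is_adjoint_ideal beta b tb &
             T @` tb = ta]),
      prime_ideal a ->
      (nondegenerate_wrt alpha a <->
        forall Q : set S, prime_ideal Q -> lies_over f Q a ->
          nondegenerate_wrt beta Q) /\
      (forall Q : set S, prime_ideal Q -> lies_over f Q a ->
        (nondegenerate_wrt alpha a -> exists ta tQ,
          is_adjoint_ideal alpha a ta /\ is_adjoint_ideal beta Q tQ) /\
        (forall ta tQ, is_adjoint_ideal alpha a ta ->
          is_adjoint_ideal beta Q tQ -> T @` tQ = ta)) &
      (purely_F_regular alpha a -> range T = setT) /\
      (purely_F_regular beta b -> range T = setT ->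
        purely_F_regular alpha a)].
Proof.
move=> b T beta.
have inj_f := dominant_inj dom_f.
have b_ideal : is_ideal b by exact/radical_is_ideal/extend_is_ideal.
have below := minimal_prime_below noethR noethS a_ideal star.
have above := minimal_prime_above fin_f inj_f noethS star.
have nd := nondegenerate_transfer
  (generic_iso_nondegenerate dom_f sigma_iso) C_tr noethR noethS a_ideal b_ideal
  below above.
split.
- rewrite /b (radical_extendE noethR noethS a_ideal star a_radical).
  exact: pairing_cartier_submodule.
- split=> // nda; have [ta Hta] := adjoint_ideal_exists noethR FfinR nda.
  have [tb Htb] := adjoint_ideal_exists noethS FfinS (nd.1 nda).
  exists ta, tb; split=> //.
  exact: (adjoint_ideal_transfer noethR noethS a_ideal b_ideal below above Hta Htb).
- move=> a_prime.
  (* A prime is its own only minimal prime, so the transfer lemmas apply to [a] and each single [Q]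
     over it. *)
  have Ma P : minimal_primes a P <-> P = a by rewrite minimal_primes_prime.
  have link Q : prime_ideal Q -> lies_over f Q a -> linked (sigma 1) Q a.
    exact: prime_over_linked.
  have MQ (Q : set S) : prime_ideal Q -> forall P, minimal_primes Q P <-> P = Q.
    by move=> Qp P; rewrite minimal_primes_prime.
  have belowQ Q : prime_ideal Q -> lies_over f Q a ->
      forall P, minimal_primes Q P ->
      exists2 P', minimal_primes a P' & linked (sigma 1) P P'.
    by move=> Qp Qa P /(MQ Q Qp) ->; exists a; [exact/Ma|exact: link].
  have aboveQ Q : prime_ideal Q -> lies_over f Q a ->
      forall P, minimal_primes a P ->
      exists2 P', minimal_primes Q P' & linked (sigma 1) P' P.
    by move=> Qp Qa P /Ma ->; exists Q; [exact/MQ|exact: link].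
  have ndQ Q : prime_ideal Q -> lies_over f Q a ->
      nondegenerate_wrt alpha a <-> nondegenerate_wrt beta Q.
    move=> Qp Qa.
    exact: (nondegenerate_transfer _ C_tr noethR noethS a_ideal
      (prime_is_ideal Qp) (belowQ Q Qp Qa) (aboveQ Q Qp Qa)).
  split.
    split=> [nda Q Qp Qa|ndall]; first exact/(ndQ Q Qp Qa).
    (* The converse requires at least one prime over [a], which [above] provides. *)
    have [Q [Qp _ _] Qa] := above a ((Ma a).2 erefl).
    have {}Qa := linked_lies_over Qp a_prime Qa.
    exact/(ndQ Q Qp Qa)/ndall.
  move=> Q Qp Qa; split=> [nda|ta tQ Hta HtQ].
    have [ta Hta] := adjoint_ideal_exists noethR FfinR nda.
    have [tQ HtQ] := adjoint_ideal_exists noethS FfinS ((ndQ Q Qp Qa).1 nda).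
    by exists ta, tQ.
  exact: (adjoint_ideal_transfer noethR noethS a_ideal
    (prime_is_ideal Qp) (belowQ Q Qp Qa) (aboveQ Q Qp Qa) Hta HtQ).
- split.
    exact: (purely_F_regular_surjective
      (generic_iso_nondegenerate dom_f sigma_iso) C_tr noethR noethS a_ideal
      b_ideal above).
  exact: (purely_F_regular_descends noethR noethS a_ideal b_ideal below).
Qed.
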